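(* Let $n\ge 1$ and let $BPM^\star_n:\{0,1\}^{n^2}\to\{0,1\}$ be the Boolean dual of the bipartite perfect matching function, written as its unique multilinear real polynomial \[BPM^\star_n(x_{1,1},\dots,x_{n,n})=\sum_{G\subseteq K_{n,n}} a^\star_G\prod_{(i,j)\in E(G)}x_{i,j}.\] Then for every $G\subseteq K_{n,n}$: (1) If $G$ is not totally ordered, then $a^\star_G=0$. (2) Otherwise, let $(d_1,k_1),\dots,(d_t,k_t)$ be the representing sequence of $G$ and let $k_0=0$. Then \[a^\star_G=\binom{n-k_{t-1}-1}{n-d_t}\cdot\prod_{i=1}^{t-1} f\bigl(d_{i+1}-k_{i-1},\ d_i-k_{i-1},\ k_i-k_{i-1}\bigr),\] where \[f(n,d,k)=\begin{cases}\binom{n-1}{k}, & d\le 0,\\[2pt] -\binom{n-d-1}{k-d}\binom{k-1}{d-1}, & d>0.\end{cases}\]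
   Context: $K_{n,n}$ has left vertices $a_1,\dots,a_n$ and right vertices $b_1,\dots,b_n$; $G\subseteq K_{n,n}$ means a graph on all these $2n$ vertices whose edge set is a subset of $E(K_{n,n})$, and the variable $x_{i,j}$ corresponds to the edge $(a_i,b_j)$. $BPM_n(x)=1$ iff the graph $\{(a_i,b_j): x_{i,j}=1\}$ has a perfect matching, and $BPM^\star_n(x_{1,1},\dots,x_{n,n})=1-BPM_n(1-x_{1,1},\dots,1-x_{n,n})$ (so $BPM^\star_n(x)=1$ iff the graph $\{(a_i,b_j):x_{i,j}=0\}$ has no perfect matching). Every Boolean function has a unique multilinear real polynomial representation; $a^\star_G$ denotes the coefficient of the monomial $\prod_{(i,j)\in E(G)}x_{i,j}$ in that of $BPM^\star_n$. $N(v)$ denotes the neighbour set of $v$. $G$ is totally ordered if there is a permutation $\pi$ of $[n]$ with $N(a_{\pi(1)})\subseteq N(a_{\pi(2)})\subseteq\dots\subseteq N(a_{\pi(n)})$. A totally ordered graph can be relabelled (permuting left vertices and, separately, right vertices) into a sorted ordered graph, i.e. one with $\deg(a_1)\le\dots\le\deg(a_n)$ and $N(a_i)=\{b_1,\dots,b_{\deg(a_i)}\}$ for all $i$. The representing sequence of (the sorted version of) $G$ is the unique sequence $(d_1,k_1),\dots,(d_t,k_t)$ of integers with $0\le d_1<\dots<d_t\le n$ and $0<k_1<\dots<k_t=n$ such that (with $k_0=0$) for each $j$ and each $k_{j-1}<i\le k_j$, $N(a_i)=\{b_1,\dots,b_{d_j}\}$. Binomial coefficients follow the convention $\binom{a}{b}=0$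 whenever $b<0$ or $b>a$. *)

(* Defs.v *)
From mathcomp Require Import all_boot all_order all_algebra perm.
From mathcomp Require Import fingroup zify.
From mathcomp Require Import reals.

Set Implicit Arguments.
Unset Strict Implicit.
Unset Printing Implicit Defensive.

Import Order.TTheory GRing.Theory Num.Theory.
Local Open Scope ring_scope.

Section Multilinear.
Variables (R : comNzRingType) (V : finType).

Definition mlpoly (a : {set V} -> R) (x : V -> R) : R :=
  \sum_(S : {set V}) a S * \prod_(v in S) x v.

Definition represents (a : {set V} -> R) (f : {ffun V -> bool} -> bool) : Prop :=
  forall x : {ffun V -> bool}, mlpoly a (fun v => (x v)%:R) = (f x)%:R.

Lemma represents_exists (f : {ffun V -> bool} -> bool) :
  exists a : {set V} -> R, represents a f.
Proof.
pose c (y : {ffun V -> bool}) (v : V) : R := if y v then 1 else -1.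
pose b (y : {ffun V -> bool}) (v : V) : R := if y v then 0 else 1.
exists (fun S : {set V} => \sum_y (f y)%:R * \prod_v (if v \in S then c y v else b y v)).
move=> x; rewrite /mlpoly.
under eq_bigr => S _ do rewrite big_distrl /=.
rewrite exchange_big /= (bigD1 x) //= [X in _ + X]big1 ?addr0.
- under eq_bigr => S _ do rewrite -mulrA [X in _ * (_ * X)]big_mkcond -big_split /=.
  rewrite -big_distrr /= -[RHS]mulr1; congr (_ * _).
  transitivity (\prod_v (c x v * (x v)%:R + b x v)).
    rewrite bigA_distr; apply: eq_bigr => S _; apply: eq_bigr => v _.
    by case: ifP; rewrite ?mulr1.
  by apply: big1 => v _; rewrite /c /b; case: (x v); rewrite ?mulr1 ?mulr0 ?add0r ?addr0.
- move=> y neq_yx.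
  under eq_bigr => S _ do rewrite -mulrA [X in _ * (_ * X)]big_mkcond -big_split /=.
  rewrite -big_distrr /=.
  have -> : \sum_(S : {set V}) \prod_v ((if v \in S then c y v else b y v) *
              (if v \in S then (x v)%:R else 1)) = \prod_v (c y v * (x v)%:R + b y v).
    rewrite bigA_distr; apply: eq_bigr => S _; apply: eq_bigr => v _.
    by case: ifP; rewrite ?mulr1.
  have [v neq_v] : exists v, y v != x v.
    apply/existsP; rewrite -negb_forall; apply: contra neq_yx => /forallP eq_yx.
    by apply/eqP/ffunP => v; apply/eqP.
  rewrite (bigD1 v) //= /c /b; move: neq_v.
  by case: (y v); case: (x v) => // _; rewrite ?mulr1 ?mulr0 ?addNr ?addr0 mul0r mulr0.
Qed.

Lemma represents_unique (f : {ffun V -> bool} -> bool) (a a' : {set V} -> R) :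
  represents a f -> represents a' f -> a =1 a'.
Proof.
move=> ha ha' S; have [m] := ubnP #|S|; elim: m S => // m IHm S /ltnSE leSm.
have sumE (c : {set V} -> R) :
  mlpoly c (fun v => ([ffun v => v \in S] v)%:R) = \sum_(T : {set V} | T \subset S) c T.
  rewrite /mlpoly [RHS]big_mkcond; apply: eq_bigr => T _; case: ifP => sTS.
    by rewrite big1 ?mulr1 // => v vT; rewrite ffunE (subsetP sTS).
  have /subsetPn[v vT vS] := negbT sTS.
  by rewrite (bigD1 v) //= ffunE (negbTE vS) mul0r mulr0.
have := ha [ffun v => v \in S]; rewrite -(ha' [ffun v => v \in S]) !sumE.
rewrite (bigD1 S) //= [in RHS](bigD1 S) //= (eq_bigr a') => [/addIr //|T /andP[sTS nTS]].
apply: IHm; apply: leq_trans leSm; apply: proper_card.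
by rewrite properEneq nTS.
Qed.

End Multilinear.

Section Bipartite.
Variable n : nat.

(* A graph G included in K_{n,n} is its edge set: (i, j) \in G is the edge
   between a_{i+1} and b_{j+1}. *)
Definition bgraph := {set 'I_n * 'I_n}.

Definition perfect_matching (G M : bgraph) : bool :=
  [&& M \subset G,
      [forall i, #|[set e in M | e.1 == i]| == 1%N] &
      [forall j, #|[set e in M | e.2 == j]| == 1%N]].

Definition BPM (x : {ffun 'I_n * 'I_n -> bool}) : bool :=
  [exists M : bgraph, perfect_matching [set e | x e] M].

Definition BPMstar (x : {ffun 'I_n * 'I_n -> bool}) : bool :=
  ~~ BPM [ffun e => ~~ x e].

Definition nbr (G : bgraph) (i : 'I_n) : {set 'I_n} := [set j | (i, j) \in G].

Definition totally_ordered (G : bgraph) : Prop :=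
  exists p : {perm 'I_n},
    forall i j : 'I_n, (i <= j)%N -> nbr G (p i) \subset nbr G (p j).

Definition relabel (p q : {perm 'I_n}) (G : bgraph) : bgraph :=
  [set (p e.1, q e.2) | e in G].

Definition sorted_ordered (G : bgraph) : Prop :=
  (forall i j : 'I_n, (i <= j)%N -> (#|nbr G i| <= #|nbr G j|)%N) /\
  (forall i : 'I_n, nbr G i = [set j : 'I_n | (j < #|nbr G i|)%N]).

(* The sequence is (d 1, k 1), ..., (d t, k t), with k 0 = 0; the values of d
   and k at other indices are irrelevant.  As vertices are numbered from 0,
   the condition k_{j-1} < i <= k_j becomes k j.-1 <= i < k j. *)
Definition sorted_representing_seq (G : bgraph) (t : nat) (d k : nat -> nat)
    : Prop :=
  [/\ (0 < t)%N,
      k 0%N = 0%N /\ k t = n,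
      (forall j, (1 <= j <= t)%N -> (k j.-1 < k j)%N),
      (forall j, (1 <= j < t)%N -> (d j < d j.+1)%N) /\ (d t <= n)%N &
      forall j (i : 'I_n), (1 <= j <= t)%N -> (k j.-1 <= i < k j)%N ->
        nbr G i = [set b : 'I_n | (b < d j)%N]].

Definition representing_seq (G : bgraph) (t : nat) (d k : nat -> nat) : Prop :=
  exists p q : {perm 'I_n},
    sorted_ordered (relabel p q G) /\
    sorted_representing_seq (relabel p q G) t d k.

End Bipartite.

Section RepresentingSeqExists.
Local Open Scope nat_scope.

Lemma card_initial n m : m <= n -> #|[set j : 'I_n | j < m]| = m.
Proof.
move=> lemn; have winj : injective (widen_ord lemn).
  by move=> i j /(congr1 val) /= ?; apply: val_inj.
rewrite -[RHS](card_ord m) -(card_imset _ winj).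
apply: eq_card => j; rewrite inE; apply/idP/imsetP => [ltjm|[i _ ->]]; last exact: (valP i).
by exists (Ordinal ltjm) => //; apply: val_inj.
Qed.

Lemma initialE n (A : {set 'I_n}) :
  (forall i j : 'I_n, i < j -> j \in A -> i \in A) -> A = [set j : 'I_n | j < #|A|].
Proof.
move=> dA; suff [m lemn defA] : exists2 m, m <= n & A = [set j : 'I_n | j < m].
  by rewrite [in #|A|]defA card_initial.
have [->|/existsP[x0 x0P]] : A = setT \/ [exists x, x \notin A].
- have [|] := boolP [exists x, x \notin A]; [by right|rewrite negb_exists => /forallP h; left].
  by apply/setP => x; rewrite inE -[LHS]negbK h.
- by exists n => //; apply/setP => j; rewrite !inE ltn_ord.
case: (@arg_minnP _ x0 (fun x => x \notin A) (fun x : 'I_n => x : nat) x0P) => x xP xmin.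
exists x; first exact: ltnW.
apply/setP => j; rewrite inE; case: ltnP => [|lexj].
  by apply: contraTT => /xmin; rewrite -leqNgt.
apply/negbTE; apply: contra xP => jA.
by move: lexj; rewrite leq_eqVlt => /orP[/eqP/val_inj->|/dA]//; exact.
Qed.

Lemma steps_exist (D : nat -> nat) m : {homo D : i j / i <= j} ->
  exists t d k, [/\ 0 < t, k 0 = 0 /\ k t = m.+1,
    (forall j, 1 <= j <= t -> k j.-1 < k j),
    (forall j, 1 <= j < t -> d j < d j.+1) /\ d t = D m &
    forall j i, 1 <= j <= t -> k j.-1 <= i < k j -> D i = d j].
Proof.
move=> hD; elim: m => [|m [t [d [k [t0 [k0 kt] hk [hd dt] hi]]]]].
  exists 1, (fun=> D 0), (fun j => j); split=> //.
  - by move=> j; lia.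
  - by split=> // j; lia.
  - by move=> j i h1 h2; congr D; lia.
have [eqD|neqD] := eqVneq (D m) (D m.+1).
  exists t, d, (fun j => if j == t then m.+2 else k j); split=> //.
  - by rewrite eqxx; case: eqP => // ?; lia.
  - move=> j hj; have /= := hk j hj; case: (j.-1 =P t) => [|_]; first by lia.
    by case: eqP => // ->; rewrite kt; lia.
  - by rewrite dt eqD.
  - move=> j i hj; case: (j.-1 =P t) => [|_]; first by lia.
    case: (j =P t) => [->|_]; last exact: hi.
    case: (ltnP i m.+1) => [lim|lemi] hh; first by apply: hi; lia.
    have -> : i = m.+1 by lia.
    by rewrite dt eqD.
have ltD : D m < D m.+1 by rewrite ltn_neqAle neqD hD.
exists t.+1, (fun j => if j == t.+1 then D m.+1 else d j),
       (fun j => if j == t.+1 then m.+2 else k j); split=> //.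
- by rewrite eqxx.
- move=> j hj; case: (j.-1 =P t.+1) => [|_]; first by lia.
  by case: eqP => [->|?]; [rewrite /= kt|apply: hk; lia].
- split; last by rewrite eqxx.
  move=> j hj; case: eqP => [|_]; first lia.
  by case: eqP => [[->]|?]; [rewrite dt|apply: hd; lia].
- move=> j i hj; case: (j.-1 =P t.+1) => [|_]; first by lia.
  case: eqP => [->|?]; last by apply: hi; lia.
  by rewrite /= kt => ?; congr D; lia.
Qed.

Lemma nbr_relabel n (p q : {perm 'I_n}) (G : bgraph n) i b :
  (q b \in nbr (relabel p q G) (p i)) = ((i, b) \in G).
Proof.
rewrite inE; apply/imsetP/idP => [[[x y] xyG /= [/perm_inj-> /perm_inj->]] //|ibG].
by exists (i, b).
Qed.

Lemma representing_seq_exists n (G : bgraph n) : 0 < n -> totally_ordered G ->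
  exists t d k, representing_seq G t d k.
Proof.
move=> n0 [p hp].
pose dg (b : 'I_n) := #|[set i | (i, b) \in G]|.
pose s := sort (fun b b' => dg b' <= dg b) (enum 'I_n).
have ss : size s = n by rewrite size_sort size_enum_ord.
have ms b : b \in s by rewrite mem_sort mem_enum.
have lts b : index b s < n by rewrite -{2}ss index_mem.
have qinj : injective (fun b => Ordinal (lts b)).
  by move=> b b' [] /(congr1 (nth b s)); rewrite !nth_index.
pose q := perm qinj.
have qP b b' : q b < q b' -> dg b' <= dg b.
  rewrite !permE /= => hlt.
  have : sorted (fun b b' => dg b' <= dg b) s.
    by apply: sort_sorted => x y; apply: leq_total.
  move=> /(sorted_ltn_nth _ b) H.
  have tr : transitive (fun b b' : 'I_n => dg b' <= dg b) by move=> ? ? ? /= h1 h2; apply: leq_trans h2 h1.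
  by have := H tr (index b s) (index b' s); rewrite !inE !index_mem !ms !nth_index //; apply.
pose G' := relabel p^-1%g q G.
have nbrE i b : (q b \in nbr G' i) = ((p i, b) \in G).
  by rewrite -{1}(permK p i) nbr_relabel.
have ini i : nbr G' i = [set j : 'I_n | j < #|nbr G' i|].
  apply: initialE => x y.
  rewrite -(permKV q x) -(permKV q y); set b' := (q^-1)%g x; set b := (q^-1)%g y.
  move=> /qP hdg; rewrite !nbrE => hb; apply: contraLR hdg => hb'; rewrite -ltnNge.
  apply: proper_card; apply/properP; split; last by exists (p i); rewrite inE.
  apply/subsetP => a; rewrite !inE -(permKV p a); set c := (p^-1)%g a => hc.
  case: (leqP i c) => [/hp /subsetP/(_ b)|/ltnW/hp /subsetP/(_ b')]; rewrite !inE.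
    by apply.
  by move=> h; rewrite h in hb'.
have homo (i j : 'I_n) : i <= j -> #|nbr G' i| <= #|nbr G' j|.
  move=> /hp /subsetP hij; apply: subset_leq_card; apply/subsetP => b.
  by rewrite -(permKV q b) !nbrE; have := hij ((q^-1)%g b); rewrite !inE.
pose D i := #|nbr G' (insubd (Ordinal n0) (minn i n.-1))|.
have [|t [d [k [t0 kk hk [hd dt] hi]]]] := @steps_exist D n.-1.
  by move=> i j lij; apply: homo; rewrite !val_insubd; do 2 case: ifP; lia.
exists t, d, k, p^-1%g, q; split; first by split.
split=> //.
- by move: kk; rewrite (prednK n0).
- by split=> //; rewrite dt (leq_trans (max_card _)) ?card_ord.
move=> j i hj hji; rewrite -(hi j i hj hji) [LHS]ini /D.
have -> : insubd (Ordinal n0) (minn i n.-1) = i; last by [].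
have lti := ltn_ord i; have -> : minn i n.-1 = i by lia.
exact: valKd.
Qed.

End RepresentingSeqExists.

(* 'C(a, b) on integers, equal to 0 when b < 0 or b > a. *)
Definition binz (a b : int) : int :=
  if (b < 0) || (a < b) then 0 else 'C(`|a|, `|b|)%N%:Z.

Definition fcoef (n d k : int) : int :=
  if d <= 0 then binz (n - 1) k
  else - (binz (n - d - 1) (k - d) * binz (k - 1) (d - 1)).

(* Main.v *)
(** By Hall's theorem, [BPMstar x = 1] iff the graph [x] contains a rectangle
    [S x T] with [#|S| + #|T| > n].  Order such rectangles by
    [(S, T) <= (S', T')] iff [S] is included in [S'] and [T'] in [T].  When there
    is one, joining with a rectangle maximising [#|S| + #|T|] contracts the poset
    of those contained in [x], so the sum of [(-1)^|c|] over its chains [c] is 0;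
    when there is none, the sum is 1.  Hence [a*_G] is, for nonempty [G], minus
    the signed number of chains of large rectangles whose union is [G].  The
    union of a chain is totally ordered, which gives (1).

    If [G] is a staircase, a chain of rectangles in [G] covers [G] iff it
    contains the maximal rectangle at each corner of [G].  The remaining
    elements lie between consecutive corners, where a rectangle in [G] shares
    its rows with the smaller corner or its columns with the larger one.  So the
    signed sum is a product over the segments between corners, and each segment
    is either a cone or the ordinal sum of two truncated Boolean lattices, whose
    Euler characteristics are signed binomial coefficients. *)

Require Import Defs.
From mathcomp Require Import all_boot all_order all_algebra perm.
From mathcomp Require Import fingroup zify ring.
From mathcomp Require Import reals.

Set Implicit Arguments.
Unset Strict Implicit.
Unset Printing Implicit Defensive.

Import Order.TTheory GRing.Theory Num.Theory.
Local Open Scope ring_scope.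

(** * Signed sums over the cliques of a reflexive symmetric relation *)

Section CliqueSums.
Variables (X : finType) (r : rel X).
Hypotheses (r_refl : reflexive r) (r_sym : symmetric r).
Implicit Types (W K c A B D : {set X}) (e x : X).

Definition clique c : bool := [forall x in c, forall y in c, r x y].

(** The empty clique counts, so this is minus the reduced Euler characteristic of the clique complex
    on [W]; for a comparability relation that is the order complex. *)
Definition chi W : int := \sum_(c : {set X} | (c \subset W) && clique c) (-1) ^+ #|c|.

Definition link W K : {set X} := [set w in W :\: K | [forall x in K, r x w]].

Lemma cliqueP c : reflect {in c &, forall x y, r x y} (clique c).
Proof.
apply: (iffP forall_inP) => [h x y xc yc|h x xc]; first exact: (forall_inP (h x xc)).
by apply/forall_inP => y; apply: h.
Qed.

Lemma clique1 e : clique [set e].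
Proof. by apply/cliqueP => x y /set1P-> /set1P->. Qed.

(** Removing [K] is a bijection from the cliques containing [K] to the cliques of the link. *)
Lemma sum_cliques_containing W K : K \subset W -> clique K ->
  \sum_(c : {set X} | [&& c \subset W, clique c & K \subset c]) (-1) ^+ #|c|
  = (-1) ^+ #|K| * chi (link W K) :> int.
Proof.
move=> sKW cK; rewrite /chi big_distrr /=.
rewrite (reindex_onto (fun c => c :|: K) (fun c => c :\: K)) /=; last first.
  move=> c /and3P[_ _ /subsetP sKc]; apply/setP => x; rewrite !inE.
  by case: (boolP (x \in K)) => [/sKc ->|] //=; rewrite orbF.
apply: eq_big => [c|c /andP[]]; last first.
  move=> _ /eqP hc; rewrite -exprD; congr (_ ^+ _).
  have dis : [disjoint c & K].
    rewrite -setI_eq0 -hc; apply/eqP/setP => x.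
    by rewrite !inE; case: (x \in K) => //=; rewrite andbF.
  by rewrite cardsU (eqP (_ : c :&: K == set0)) ?setI_eq0 // cards0 subn0 addnC.
apply/idP/idP.
  move=> /andP[/and3P[sW /cliqueP cl _] /eqP hc]; apply/andP; split.
    apply/subsetP => x xc; have := xc; rewrite -hc !inE => /andP[nK _].
    rewrite nK (subsetP sW) ?inE ?xc //=; apply/forall_inP => y yK.
    by apply: cl; rewrite !inE ?yK ?xc ?orbT.
  by apply/cliqueP => x y xc yc; apply: cl; rewrite !inE ?xc ?yc.
move=> /andP[/subsetP sl /cliqueP cl].
have sl' x : x \in c -> [/\ x \in W, x \notin K & {in K, forall y, r y x}].
  by move=> /sl; rewrite !inE => /andP[/andP[? ?] /forall_inP].
apply/andP; split; last first.
  apply/eqP/setP => x; rewrite !inE; case: (boolP (x \in c)) => [/sl'[_ -> _]//|_].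
  by case: (x \in K).
apply/and3P; split; last exact: subsetUr.
  by rewrite subUset sKW andbT; apply/subsetP => x /sl'[].
apply/cliqueP => x y; rewrite !inE => /orP[xc|xK] /orP[yc|yK].
- exact: cl.
- by rewrite r_sym; case: (sl' _ xc) => _ _; apply.
- by case: (sl' _ yc) => _ _; apply.
- exact: (cliqueP _ cK).
Qed.

Lemma chi_delete W e : e \in W -> chi W = chi (W :\ e) - chi (link W [set e]).
Proof.
move=> eW; rewrite {1}/chi (bigID (fun c => [set e] \subset c)) /= addrC.
under [X in _ + X = _]eq_bigl => c do rewrite -andbA.
rewrite sum_cliques_containing ?sub1set ?clique1 // cards1 expr1 mulN1r; congr (_ - _).
by apply: eq_bigl => c; rewrite sub1set subsetD1 -!andbA; congr (_ && _); rewrite andbC.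
Qed.

Lemma chi0 : chi set0 = 1.
Proof.
rewrite /chi (bigD1 set0) /=.
  rewrite cards0 expr0 big1 ?addr0 // => c /andP[/andP[]].
  by rewrite subset0 => ->.
by rewrite subxx; apply/cliqueP => x y; rewrite inE.
Qed.

(** The link of the apex [e] is all of [W :\ e], so the two terms of [chi_delete] cancel. *)
Lemma chi_cone W e : e \in W -> {in W, forall x, r e x} -> chi W = 0.
Proof.
move=> eW h; rewrite (chi_delete eW); apply/eqP; rewrite subr_eq0; apply/eqP.
congr chi; apply/setP => x; rewrite !inE; case: eqP => //= _.
case: (boolP (x \in W)) => //= xW; apply/esym/forall_inP => y /set1P ->.
exact: h.
Qed.

(** The induction deletes a vertex of [A]: its link in the union is its link in [A] joined with
    [B]. *)
Lemma chi_join A B : [disjoint A & B] -> {in A & B, forall x y, r x y} ->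
  chi (A :|: B) = chi A * chi B.
Proof.
have [m] := ubnP #|A|; elim: m A => // m IHm A /ltnSE leAm dAB rAB.
have [->|/set0Pn[e eA]] := eqVneq A set0; first by rewrite set0U chi0 mul1r.
have eB : e \notin B by apply: (contraL _ dAB) => eB; apply/pred0Pn; exists e; rewrite /= eA.
rewrite (chi_delete eA) (@chi_delete _ e) ?inE ?eA // mulrBl.
have card_lt A' : A' \subset A :\ e -> (#|A'| < m)%N.
  by move=> /subset_leq_card s; rewrite (leq_ltn_trans s) //; rewrite (cardsD1 e) eA in leAm.
have dis A' : A' \subset A :\ e -> [disjoint A' & B].
  by move=> s; apply: disjointWl dAB; apply: subset_trans s (subD1set _ _).
have rel A' : A' \subset A :\ e -> {in A' & B, forall x y, r x y}.
  by move=> /subsetP s x y /s; rewrite !inE => /andP[_ xA]; apply: rAB.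
have sl : link A [set e] \subset A :\ e.
  by apply/subsetP => x; rewrite !inE => /andP[].
rewrite -!IHm ?card_lt ?dis //; last 2 first.
- exact: rel.
- exact: rel.
congr (chi _ - chi _); apply/setP => x; rewrite !inE.
  by case: eqP => // ->; rewrite (negbTE eB).
case: (eqVneq x e) => [->|_] /=; first by rewrite (negbTE eB).
case: (boolP (x \in B)) => [xB|_]; last by rewrite !orbF.
by rewrite !orbT; apply/forall_inP => y /set1P ->; apply: rAB.
Qed.

Lemma chi_bigjoin (F : nat -> {set X}) m :
  (forall i j, (i < j < m)%N -> [disjoint F i & F j]) ->
  (forall i j, (i < j < m)%N -> {in F i & F j, forall x y, r x y}) ->
  chi (\bigcup_(i < m) F i) = \prod_(i < m) chi (F i).
Proof.
elim: m => [|m IHm] dF rF; first by rewrite !big_ord0 chi0.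
rewrite !big_ord_recr /= chi_join ?IHm //.
- by move=> i j h; apply: dF; lia.
- by move=> i j h; apply: rF; lia.
- rewrite disjoint_sym disjoints_subset; apply/subsetP => x xF; rewrite inE.
  apply/bigcupP => -[i _ xi].
  by have /pred0P/(_ x) := dF i m ltac:(have := ltn_ord i; lia); rewrite /= xi xF.
- by move=> x y /bigcupP[i _ xi] ym; apply: (rF i m) => //; have := ltn_ord i; lia.
Qed.

(** Distinct elements of [D] are unrelated, so deleting one leaves the links of the others
    unchanged. *)
Lemma chi_delete_set W D : D \subset W -> {in D &, forall x y, r x y -> x = y} ->
  chi W = chi (W :\: D) - \sum_(e in D) chi (link W [set e]).
Proof.
have [m] := ubnP #|D|; elim: m W D => // m IHm W D /ltnSE leDm sDW aD.
have [->|/set0Pn[e eD]] := eqVneq D set0; first by rewrite setD0 big_set0 subr0.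
rewrite (chi_delete (subsetP sDW e eD)) (IHm _ (D :\ e)) ?setSD //; last 2 first.
- by rewrite (cardsD1 e) eD in leDm.
- by move=> x y /setD1P[_ xD] /setD1P[_ yD]; apply: aD.
rewrite [in RHS](big_setD1 e) //= -addrA -opprD; congr (chi _ - _).
  by apply/setP => x; rewrite !inE; case: eqP => [->|_] //=; rewrite eD.
rewrite addrC; congr (_ + _); apply: eq_bigr => y /setD1P[ney yD]; congr chi.
apply/setP => x; rewrite !inE; case: (eqVneq x e) => [->|] //=.
rewrite andbF; apply/esym/negbTE; rewrite negb_and; apply/orP; right.
apply: contra ney => /forall_inP/(_ y); rewrite inE eqxx => /(_ isT) rye.
by apply/eqP/aD.
Qed.

End CliqueSums.

Lemma chi_imset (X Y : finType) (r : rel X) (s : rel Y) (f : X -> Y) (W : {set X}) :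
  injective f -> {mono f : x y / r x y >-> s x y} -> chi s (f @: W) = chi r W.
Proof.
move=> fI fM; rewrite /chi (reindex_onto (fun c : {set X} => f @: c) (fun c => f @^-1: c)) /=.
  apply: eq_big => [c|c _]; last by rewrite card_imset.
  have -> : f @^-1: (f @: c) == c.
    by apply/eqP/setP => x; rewrite inE mem_imset.
  rewrite andbT; congr (_ && _).
    apply/subsetP/subsetP => h x; last by case/imsetP=> y /h yW ->; rewrite mem_imset.
    by move=> xc; rewrite -(mem_imset _ _ fI); apply: h; rewrite mem_imset.
  apply/cliqueP/cliqueP => h x y; last by do 2![case/imsetP=> ? ? ->]; rewrite fM; apply: h.
  by move=> xc yc; rewrite -fM; apply: h; rewrite mem_imset.
move=> c /andP[/subsetP sW _]; apply/setP => y; apply/imsetP/idP => [[x]|yc].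
  by rewrite inE => ? ->.
by have /imsetP[x _ eyx] := sW y yc; exists x => //; rewrite inE -eyx.
Qed.

(** * Euler characteristics of truncated Boolean lattices *)

Section TruncatedCube.
Variable T : finType.
Implicit Types A B C : {set T}.

Definition nested A B := (A \subset B) || (B \subset A).

Lemma nested_refl : reflexive nested.
Proof. by move=> A; rewrite /nested subxx. Qed.

Lemma nested_sym : symmetric nested.
Proof. by move=> A B; rewrite /nested orbC. Qed.

(** The open interval from [A] to [B] without its [m] lowest levels. *)
Definition tcube A B m : {set {set T}} :=
  [set C : {set T} | [&& A \subset C, C \proper B & (#|A| + m < #|C|)%N]].

Lemma chi_tcube_small A B m : (#|B| <= (#|A| + m).+1)%N -> chi nested (tcube A B m) = 1.
Proof.
move=> le; suff -> : tcube A B m = set0 by rewrite chi0.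
by apply/setP => C; rewrite !inE; apply/and3P => -[_ /proper_card]; lia.
Qed.

(* The sets of the lowest level form an antichain, and the sets above one of
   them form an open interval, that is a cube truncated only at its top. *)
Lemma chi_tcube A B m : A \subset B -> (#|A| + m < #|B|)%N ->
  chi nested (tcube A B m)
  = (-1) ^+ (#|B| - #|A| - m).-1 * 'C((#|B| - #|A|).-1, m)%:R.
Proof.
(* The outer induction serves the intervals above a lowest set, the inner one the cube with one more
   level removed. *)
have [N] := ubnP (#|B| - #|A|)%N; elim: N A m => // N IHN A m /ltnSE leN sAB.
have [u] := ubnP (#|B| - #|A| - m)%N; elim: u m => // u IHu m /ltnSE leu ltm.
have [eqm|neqm] := eqVneq #|B| (#|A| + m).+1.
  have -> : (#|B| - #|A| - m).-1 = 0%N by lia.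
  have -> : (#|B| - #|A|).-1 = m by lia.
  by rewrite chi_tcube_small ?eqm // binn mul1r.
pose D := [set C in tcube A B m | #|C| == (#|A| + m).+1].
rewrite (@chi_delete_set _ nested nested_refl nested_sym _ D); last 2 first.
- by apply/subsetP => C; rewrite inE => /andP[].
- move=> C C'; rewrite !inE => /andP[_ /eqP cC] /andP[_ /eqP cC'].
  by case/orP => s; apply/eqP; [|rewrite eq_sym]; rewrite eqEcard s cC cC' leqnn.
have -> : tcube A B m :\: D = tcube A B m.+1.
  apply/setP => C; rewrite !inE; case: (A \subset C) => //=; case: (C \proper B) => //=.
  by apply/idP/idP; lia.
rewrite IHu //; try lia.
rewrite (eq_bigr (fun=> (-1) ^+ (#|B| - #|A| - m).-2)); last first.
  move=> C; rewrite !inE => /andP[/and3P[sAC pCB ltC] /eqP cC].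
  have -> : link nested (tcube A B m) [set C] = tcube C B 0.
    apply/setP => C'; rewrite !inE addn0.
    have -> : [forall x in [set C], nested x C'] = nested C C'.
      by apply/forall_inP/idP => [-> //|h x /set1P->//]; rewrite inE.
    apply/idP/idP.
      move=> /andP[/andP[neC /and3P[sAC' pC'B ltC']] /orP[s|s]].
        rewrite s pC'B ltn_neqAle subset_leq_card ?andbT //; apply: contra neC => /eqP e.
        by rewrite eq_sym eqEcard s e leqnn.
      by case/eqP: neC; apply/eqP; rewrite eqEcard s; lia.
    move=> /and3P[s pC'B ltC']; rewrite pC'B (subset_trans sAC s) /nested s /= andbT.
    by apply/andP; split; [apply: contraTneq ltC' => ->; rewrite ltnn|lia].
  have lCB := proper_card pCB.
  rewrite IHN ?proper_sub //; try lia.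
  by rewrite subn0 bin0 mulr1; congr (_ ^+ _); lia.
rewrite sumr_const.
have -> : #|D| = 'C(#|B| - #|A|, m.+1).
  rewrite -cardsDS //.
  have <- : [set A :|: C | C in [set C : {set T} | C \subset B :\: A & #|C| == m.+1]] = D.
    apply/setP => C; rewrite !inE; apply/imsetP/idP.
      move=> [E]; rewrite inE subsetD => /andP[/andP[sEB dEA] /eqP cE] ->.
      have cAE : #|A :|: E| = (#|A| + m).+1.
        by rewrite cardsU setIC (eqP (_ : E :&: A == set0)) ?setI_eq0 // cards0 subn0 cE addnS.
      rewrite subsetUl properEcard subUset sAB sEB cAE; lia.
    move=> /andP[/and3P[sAC /proper_sub sCB _] /eqP cC].
    exists (C :\: A); last first.
      by apply/setP => x; rewrite !inE; case: (boolP (x \in A)) => // /(subsetP sAC) ->.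
    by rewrite inE setSD //= cardsDS // cC; apply/eqP; lia.
  rewrite card_in_imset ?cards_draws // => E E'; rewrite !inE !subsetD.
  move=> /andP[/andP[_ /pred0P d] _] /andP[/andP[_ /pred0P d'] _] /setP e; apply/setP => x.
  by have := e x; have := d x; have := d' x; rewrite !inE /=; do 3!case: (x \in _).
case eN : (#|B| - #|A|)%N => [|M]; first by lia.
have -> : (M.+1 - m.+1).-1 = (M.+1 - m).-2 by lia.
have -> : (M.+1 - m).-1 = ((M.+1 - m).-2).+1 by lia.
(* By Pascal's rule, subtracting the size of the removed level turns the binomial at [m.+1] into
   minus the one at [m]. *)
rewrite binS /= mulrnDr exprS -!(mulr_natr ((-1) ^+ _)); move: ((-1) ^+ _) => s.
by move: (_%:R) (_%:R) => a b; ring.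
Qed.

End TruncatedCube.

(** * Contraction of a poset by joining with a fixed element *)

Section ConicalSums.
Variables (X : finType) (le : rel X).
Hypotheses (le_refl : reflexive le) (le_trans : transitive le) (le_anti : antisymmetric le).

Definition comp_rel : rel X := fun x y => le x y || le y x.

Lemma comp_rel_refl : reflexive comp_rel.
Proof. by move=> x; rewrite /comp_rel le_refl. Qed.

Lemma comp_rel_sym : symmetric comp_rel.
Proof. by move=> x y; rewrite /comp_rel orbC. Qed.

(* The link of an element p that is maximal among those not above m is a cone
   with apex j p, so that p can be deleted. *)
Lemma chi_conical (W : {set X}) (m : X) (j : X -> X) : m \in W ->
  {in W, forall p, [/\ j p \in W, le p (j p) & le m (j p)]} ->
  {in W &, forall p q, le p q -> le m q -> le (j p) q} ->
  chi comp_rel W = 0.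
Proof.
have [N] := ubnP #|W|; elim: N W => // N IHN W /ltnSE leN mW jW jmin.
have [/forall_inP h|] := boolP [forall x in W, le m x].
  by apply: (chi_cone comp_rel_refl comp_rel_sym mW) => x /h; rewrite /comp_rel => ->.
rewrite negb_forall_in => /exists_inP[p0 p0W np0].
have p0P : (p0 \in W) && ~~ le m p0 by rewrite p0W.
(* Having the fewest elements above it makes [p] maximal among the elements not above [m]. *)
case: (@arg_minnP _ p0 (fun p => (p \in W) && ~~ le m p) (fun p => #|[set q | le p q]|) p0P).
move=> p /andP[pW np] pmin.
have pmax q : q \in W -> le p q -> q != p -> le m q.
  move=> qW lpq neq; apply/idPn => nq; have := pmin q; rewrite qW nq => /(_ isT).
  rewrite leqNgt => /negP; apply; apply: proper_card; apply/properP; split.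
    by apply/subsetP => x; rewrite !inE; apply: le_trans.
  exists p; rewrite !inE ?le_refl //; apply: contra neq => lqp; apply/eqP/le_anti.
  by rewrite lpq lqp.
have [jpW lpj lmj] := jW p pW.
have nejp : j p != p by apply: contra np => /eqP e; rewrite -e.
rewrite (chi_delete comp_rel_refl comp_rel_sym pW) IHN; first last.
- by move=> x q /setD1P[_ xW] /setD1P[_ qW]; apply: jmin.
- move=> q /setD1P[neq qW]; have [? ? lmq] := jW q qW; split=> //.
  by rewrite !inE andbC; apply/andP; split=> //; apply: contra np => /eqP <-.
- by rewrite !inE mW andbT; apply: contraNneq np => <-.
- by rewrite (cardsD1 p) pW in leN.
rewrite sub0r (@chi_cone _ _ comp_rel_refl comp_rel_sym _ (j p)) ?oppr0 //.
  rewrite !inE nejp jpW; apply/forall_inP => x /set1P ->.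
  by rewrite /comp_rel lpj.
(* An element above [p] is above [m] by maximality, hence above [j p]; an element below [p] is below
   [j p]. *)
move=> x; rewrite !inE => /andP[/andP[nex xW]] /forall_inP/(_ p).
rewrite inE eqxx => /(_ isT) /orP[lpx|lxp]; rewrite /comp_rel.
  by rewrite (jmin p x) // pmax.
by rewrite (le_trans lxp lpj) orbT.
Qed.

End ConicalSums.

(** * Hall's marriage theorem *)

Section Hall.
Variable n : nat.
Implicit Types (G M : bgraph n) (S : {set 'I_n}).

Definition nbrs G S : {set 'I_n} := \bigcup_(i in S) nbr G i.

Lemma nbrsP G S b : reflect (exists2 i, i \in S & (i, b) \in G) (b \in nbrs G S).
Proof.
apply: (iffP bigcupP) => [[i iS]|[i iS ib]]; first by rewrite inE; exists i.
by exists i; rewrite ?inE.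
Qed.

Definition hall_cond G : bool := [forall S : {set 'I_n}, (#|S| <= #|nbrs G S|)%N].

Lemma hall_cond_matching G M : perfect_matching G M -> hall_cond G.
Proof.
move=> /and3P[sMG /forallP h1 /forallP h2]; apply/forallP => S.
pose E := [set e in M | e.1 \in S].
have inj2 : {in E &, injective (fun e : 'I_n * 'I_n => e.2)}.
  move=> e e'; rewrite !inE => /andP[eM _] /andP[e'M _] eq2.
  have /cards1P[x /setP hx] := h2 e.2; have := hx e; have := hx e'.
  by rewrite !inE eM e'M eq2 !eqxx => /esym/eqP -> /esym/eqP.
have sS : S \subset [set e.1 | e in E].
  apply/subsetP => i iS; have /cards1P[x /setP hx] := h1 i.
  have := hx x; rewrite !inE eqxx => /andP[xM /eqP xi]; apply/imsetP.
  by exists x; rewrite ?inE ?xM ?xi.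
apply: leq_trans (subset_leq_card sS) _; apply: leq_trans (leq_imset_card _ _) _.
rewrite -(card_in_imset inj2); apply: subset_leq_card; apply/subsetP => b /imsetP[[x y]].
rewrite !inE /= => /andP[xyM xS] ->; apply/nbrsP; exists x => //.
exact: (subsetP sMG).
Qed.

(* Rado's argument: in an inclusion-minimal graph satisfying Hall's condition
   every left vertex has degree one, by submodularity of the neighbourhood. *)
Lemma minimal_hall_unique M (a b1 b2 : 'I_n) : minset hall_cond M ->
  (a, b1) \in M -> (a, b2) \in M -> b1 = b2.
Proof.
move=> /minsetP[hM minM] ab1 ab2; apply/eqP/idPn => neb.
(* Deleting an edge at [a] must break Hall's condition, and it can do so only for a set containing
   [a]. *)
have viol b : (a, b) \in M ->
    exists2 A : {set 'I_n}, a \in A & (#|nbrs (M :\ (a, b)) A| < #|A|)%N.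
  move=> abM; have : ~~ hall_cond (M :\ (a, b)).
    apply/negP => /minM /(_ (subD1set _ _)) /setP/(_ (a, b)).
    by rewrite abM !inE eqxx.
  rewrite negb_forall => /existsP[A]; rewrite -ltnNge => ltA; exists A => //.
  apply: contraLR ltA => naA; rewrite -leqNgt.
  apply: leq_trans (forallP hM A) _; apply: subset_leq_card; apply/subsetP => y.
  move=> /nbrsP[x xA xyM]; apply/nbrsP; exists x => //; rewrite !inE xyM andbT.
  by apply: contraNneq naA => -[<- _].
have [A1 aA1 lt1] := viol _ ab1; have [A2 aA2 lt2] := viol _ ab2.
set N1 := nbrs _ A1 in lt1; set N2 := nbrs _ A2 in lt2.
(* Each of the two deleted edges survives in the other graph, where its endpoint [a] still
   counts. *)
have hU : (#|A1 :|: A2| <= #|N1 :|: N2|)%N.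
  apply: leq_trans (forallP hM _) _; apply: subset_leq_card; apply/subsetP => y.
  move=> /nbrsP[x xA xyM]; rewrite inE; case/setUP: xA => xA.
    have [[ex ey]|ne] := eqVneq (x, y) (a, b1).
      apply/orP; right; apply/nbrsP; exists a => //.
      by rewrite !inE -ex xyM andbT ex ey xpair_eqE eqxx.
    by apply/orP; left; apply/nbrsP; exists x => //; rewrite !inE ne.
  have [[ex ey]|ne] := eqVneq (x, y) (a, b2).
    apply/orP; left; apply/nbrsP; exists a => //.
    by rewrite !inE -ex xyM andbT ex ey xpair_eqE eqxx eq_sym.
  by apply/orP; right; apply/nbrsP; exists x => //; rewrite !inE ne.
(* All deleted edges start at [a], so the other vertices keep their neighbours in both graphs.
   Adding this to [hU] gives a total of at least [#|A1| + #|A2| - 1] for [#|N1| + #|N2|], one more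
   than the violations allow. *)
have hI : (#|(A1 :&: A2) :\ a| <= #|N1 :&: N2|)%N.
  apply: leq_trans (forallP hM _) _; apply: subset_leq_card; apply/subsetP => y.
  move=> /nbrsP[x]; rewrite !inE => /and3P[nea x1 x2] xyM.
  by apply/andP; split; apply/nbrsP; exists x; rewrite // !inE xyM xpair_eqE (negbTE nea).
have arith u i i' a1 a2 v w n1 n2 : i = (1 + i')%N -> (v + w = n1 + n2)%N ->
  (u + i = a1 + a2)%N -> (u <= v)%N -> (i' <= w)%N -> (n1 < a1)%N -> (n2 < a2)%N -> False by lia.
apply: arith (cardsUI N1 N2) (cardsUI A1 A2) hU hI lt1 lt2.
by rewrite (cardsD1 a) inE aA1 aA2.
Qed.

(** A minimal subgraph satisfying Hall's condition is itself a matching: its left vertices have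
    degree one, and two of them sharing a neighbour would violate the condition. *)
Lemma matching_hall_cond G : hall_cond G -> [exists M, perfect_matching G M].
Proof.
move=> hG; have [M Mmin sMG] := minset_exists hG.
have uniqM := minimal_hall_unique Mmin; have /minsetP[/forallP hM _] := Mmin.
apply/existsP; exists M; rewrite /perfect_matching sMG /=; apply/andP; split.
  apply/forallP => i; have : (0 < #|nbrs M [set i]|)%N by have := hM [set i]; rewrite cards1.
  move=> /card_gt0P[b /nbrsP[_ /set1P -> ibM]]; apply/cards1P; exists (i, b).
  apply/setP => -[x y]; rewrite !inE xpair_eqE /=; apply/andP/andP.
    by move=> [xyM /eqP exi]; rewrite exi in xyM *; rewrite (uniqM _ _ _ xyM ibM) !eqxx.
  by move=> [/eqP -> /eqP ->].
apply/forallP => j.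
have jN : j \in nbrs M setT.
  suff -> : nbrs M setT = setT by rewrite inE.
  by apply/eqP; rewrite eqEcard subsetT hM.
have /nbrsP[i _ ijM] := jN; apply/cards1P; exists (i, j).
apply/setP => -[x y]; rewrite !inE xpair_eqE /=; apply/andP/andP; last by move=> [/eqP-> /eqP->].
move=> [xyM /eqP ey]; rewrite ey eqxx in xyM *; split=> //.
apply/negPn/negP => nexi; have := hM [set x; i]; rewrite cards2 nexi leqNgt => /negP; apply.
suff: (#|nbrs M [set x; i]| <= #|[set j]|)%N by rewrite cards1.
apply: subset_leq_card; apply/subsetP => b.
move=> /nbrsP[a /set2P[] -> abM]; rewrite inE; apply/eqP.
  exact: uniqM abM xyM.
exact: uniqM abM ijM.
Qed.

Lemma hall G : [exists M, perfect_matching G M] = hall_cond G.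
Proof.
apply/idP/idP; last exact: matching_hall_cond.
by case/existsP=> M /hall_cond_matching.
Qed.

End Hall.

(** * Large rectangles, their chains and the coefficients of the dual polynomial *)

Section Rectangles.
Variable n : nat.
Local Notation rect := ({set 'I_n} * {set 'I_n})%type.
Implicit Types (G : bgraph n) (p q : rect) (c : {set rect}).

Definition rect_le : rel rect := fun p q => (p.1 \subset q.1) && (q.2 \subset p.2).

Definition rect_comp : rel rect := comp_rel rect_le.

Lemma rect_le_refl : reflexive rect_le.
Proof. by move=> p; rewrite /rect_le !subxx. Qed.

Lemma rect_le_trans : transitive rect_le.
Proof.
move=> q p s /andP[pq1 pq2] /andP[qs1 qs2].
by rewrite /rect_le (subset_trans pq1 qs1) (subset_trans qs2 pq2).
Qed.

Lemma rect_le_anti : antisymmetric rect_le.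
Proof.
move=> [A B] [A' B'] /andP[/andP[/= s1 s2] /andP[/= s3 s4]].
by congr (_, _); apply/eqP; rewrite eqEsubset ?s1 ?s2 ?s3 ?s4.
Qed.

Lemma rect_comp_refl : reflexive rect_comp.
Proof. exact: comp_rel_refl rect_le_refl. Qed.

Lemma rect_comp_sym : symmetric rect_comp.
Proof. exact: comp_rel_sym. Qed.

Definition area p : bgraph n := setX p.1 p.2.

Lemma in_area p i b : ((i, b) \in area p) = (i \in p.1) && (b \in p.2).
Proof. by rewrite !inE. Qed.

Definition large p : bool := (n < #|p.1| + #|p.2|)%N.

Definition rects G : {set rect} := [set p : rect | large p && (area p \subset G)].

Definition covered c : bgraph n := \bigcup_(p in c) area p.

(** A set [S] violates Hall's condition in the complement exactly when [S] and the columns joined in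
    [G] to all of [S] form a large rectangle. *)
Lemma rects_neq0 G : (rects G != set0) = ~~ hall_cond (~: G).
Proof.
rewrite negb_forall; apply/set0Pn/existsP.
  move=> [[S T]]; rewrite inE /large /= => /andP[lg /subsetP sG]; exists S.
  rewrite -ltnNge; have : (#|nbrs (~: G) S| <= #|~: T|)%N.
    apply/subset_leq_card/subsetP => b /nbrsP[i iS]; rewrite !inE; apply: contra => bT.
    by apply: sG; rewrite in_area iS bT.
  have arith s t u v : (n < s + t)%N -> (t + u = n)%N -> (v <= u)%N -> (v < s)%N by lia.
  by apply: arith lg _; have := cardsC T; rewrite card_ord.
move=> [S]; rewrite -ltnNge => ltS; exists (S, ~: nbrs (~: G) S).
rewrite inE; apply/andP; split.
  have arith s t u : (t < s)%N -> (t + u = n)%N -> (n < s + u)%N by lia.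
  by apply: arith ltS _; have := cardsC (nbrs (~: G) S); rewrite card_ord.
apply/subsetP => -[i b]; rewrite in_area /= inE => /andP[iS].
by apply: contraR => nG; apply/nbrsP; exists i; rewrite ?inE.
Qed.

Lemma BPMstar_rects (x : {ffun 'I_n * 'I_n -> bool}) :
  BPMstar x = (rects [set e | x e] != set0).
Proof.
rewrite rects_neq0 /BPMstar /BPM hall; congr (~~ hall_cond _).
by apply/setP => e; rewrite !inE ffunE.
Qed.

(* Joining with a rectangle of maximal semiperimeter stays within [rects G]. *)
Lemma chi_rects G : chi rect_comp (rects G) = (rects G == set0)%:R.
Proof.
have [->|/set0Pn[m0 m0R]] := eqVneq (rects G) set0; first exact: chi0.
case: (@arg_maxnP _ m0 (fun p => p \in rects G) (fun p => #|p.1| + #|p.2|)%N m0R) => m mR mmax.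
pose j p : rect := (p.1 :|: m.1, p.2 :&: m.2).
apply: (@chi_conical _ _ rect_le_refl rect_le_trans rect_le_anti _ m j) => //; last first.
  move=> p q _ _ /andP[s1 s2] /andP[s3 s4].
  by rewrite /rect_le /= subUset s1 s3 subsetI s2 s4.
move=> p pR; have [/andP[lp /subsetP sp] /andP[lm /subsetP sm]] :
  (large p && (area p \subset G)) /\ (large m && (area m \subset G)).
  by move: pR mR; rewrite !inE.
split; last 2 first.
- by rewrite /rect_le /= subsetUl subsetIl.
- by rewrite /rect_le /= subsetUr subsetIr.
(* The semiperimeters of [j p] and [w] add up to those of [p] and [m]. As that of [w] is at most
   that of [m], [j p] is at least as large as [p]. *)
pose w : rect := (p.1 :&: m.1, p.2 :|: m.2).
have sw : area w \subset G.
  apply/subsetP => -[i b]; rewrite in_area !inE => /andP[/andP[i1 i2] /orP[h|h]].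
    by apply: sp; rewrite in_area i1 h.
  by apply: sm; rewrite in_area i2 h.
have lw : (#|w.1| + #|w.2| <= #|m.1| + #|m.2|)%N.
  have [le|lt] := leqP (#|w.1| + #|w.2|) n; first by apply: leq_trans le (ltnW lm).
  by apply: mmax; rewrite inE /large lt sw.
rewrite inE; apply/andP; split.
  have arith a b u i a' b' u' i' : (u + i = a + b)%N -> (u' + i' = a' + b')%N ->
    (i + u' <= b + b')%N -> (n < a + a')%N -> (n < u + i')%N by lia.
  exact: arith (cardsUI p.1 m.1) (cardsUI p.2 m.2) lw lp.
apply/subsetP => -[i b]; rewrite in_area !inE => /andP[/orP[h|h] /andP[b1 b2]].
  by apply: sp; rewrite in_area h b1.
by apply: sm; rewrite in_area h b2.
Qed.

Definition chains : {set {set rect}} :=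
  [set c : {set rect} | [forall p in c, large p] && clique rect_comp c].

(* Moebius inversion of [BPMstar x = 1 - chi (rects x)]. *)
Definition coef_star G : int :=
  (G == set0)%:R - \sum_(c in chains | covered c == G) (-1) ^+ #|c|.

Lemma subset_rects c G : (c \subset rects G) = [forall p in c, large p] && (covered c \subset G).
Proof.
apply/subsetP/andP => [h|[/forall_inP h1 /bigcupsP h2] p pc]; last by rewrite inE h1 ?h2.
split; first by apply/forall_inP => p /h; rewrite inE => /andP[].
by apply/bigcupsP => p /h; rewrite inE => /andP[].
Qed.

(** Grouping the chains in [rects g] by the subgraph of [g] they cover, the coefficients of all
    subgraphs of [g] add up to [1 - chi (rects g)]. *)
Lemma represents_coef_star (R : comNzRingType) :
  represents (fun G => (coef_star G)%:~R : R) (@BPMstar n).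
Proof.
move=> x; pose g := [set e | x e].
have -> : mlpoly (fun G => (coef_star G)%:~R : R) (fun v => (x v)%:R)
  = (\sum_(G : bgraph n | G \subset g) coef_star G)%:~R.
  rewrite /mlpoly rmorph_sum [RHS]big_mkcond /=; apply: eq_bigr => G _; case: ifP => sG.
    rewrite big1 ?mulr1 // => v vG.
    by have := subsetP sG v vG; rewrite inE => ->.
  have /subsetPn[v vG] := negbT sG; rewrite inE => /negbTE vx.
  by rewrite (bigD1 v) //= vx mul0r mulr0.
have -> : (BPMstar x)%:R = ((BPMstar x)%:R : int)%:~R :> R by case: (BPMstar x).
congr (_%:~R); rewrite BPMstar_rects -/g sumrB.
have -> : \sum_(G : bgraph n | G \subset g) (G == set0)%:R = 1 :> int.
  by rewrite (bigD1 set0) ?sub0set //= eqxx big1 ?addr0 // => G /andP[_ /negbTE ->].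
have -> : \sum_(G : bgraph n | G \subset g) \sum_(c in chains | covered c == G) (-1) ^+ #|c|
  = chi rect_comp (rects g).
  rewrite (exchange_big_dep (mem chains)) //=; last by move=> G c _ /andP[].
  rewrite /chi [RHS](eq_bigl (fun c => (c \in chains) && (covered c \subset g))); last first.
    by move=> c; rewrite subset_rects inE -!andbA; congr (_ && _); rewrite andbC.
  rewrite big_mkcondr /=; apply: eq_bigr => c cC; case: ifP => sc.
    rewrite (bigD1 (covered c)) ?sc ?cC ?eqxx //= big1 ?addr0 // => G.
    by move=> /andP[/andP[_ /eqP->]]; rewrite eqxx.
  by rewrite big1 // => G /andP[sG /andP[_ /eqP e]]; rewrite e sG in sc.
by rewrite chi_rects; case: eqP.
Qed.

Lemma nested_totally_ordered G :
  (forall i j, nested (nbr G i) (nbr G j)) -> totally_ordered G.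
Proof.
move=> nG; pose s := sort (relpre (fun i => #|nbr G i|) leq) (enum 'I_n).
have ss : size s = n by rewrite size_sort size_enum_ord.
have us : uniq s by rewrite sort_uniq enum_uniq.
pose f (i : 'I_n) := nth i s i.
have fI : injective f.
  move=> i j; rewrite /f (set_nth_default j) ?ss // => /eqP.
  by rewrite nth_uniq ?ss // => /eqP/val_inj.
exists (perm fI) => i j lij; rewrite !permE.
have : (#|nbr G (f i)| <= #|nbr G (f j)|)%N.
  have srt : sorted (relpre (fun i => #|nbr G i|) leq) s.
    by apply: sort_sorted => x y; apply: leq_total.
  have tr : transitive (relpre (fun i => #|nbr G i|) leq).
    by move=> a b c /= h1 h2; apply: leq_trans h1 h2.
  have rf : reflexive (relpre (fun i => #|nbr G i|) leq) by move=> a /=.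
  have := sorted_leq_nth tr rf i srt; move/(_ i j); rewrite !inE ss !ltn_ord => /(_ isT isT lij).
  by rewrite /= /f (@set_nth_default _ s i j j) ?ss.
case/orP: (nG (f i) (f j)) => // sub le.
by have /eqP -> : nbr G (f j) == nbr G (f i) by rewrite eqEcard sub.
Qed.

(** The larger of two comparable rectangles has all rows of the smaller, so with [(i, b)] and
    [(j, b')] a chain also covers [(i, b')] or [(j, b)]. *)
Lemma covered_nested c i j : c \in chains -> nested (nbr (covered c) i) (nbr (covered c) j).
Proof.
rewrite inE => /andP[_ /cliqueP cl]; apply/idPn; rewrite negb_or.
move=> /andP[/subsetPn[b bi nbj] /subsetPn[b' bj nbi]].
move: bi bj; rewrite !inE => /bigcupP[p pc]; rewrite in_area => /andP[ip bp].
move=> /bigcupP[q qc]; rewrite in_area => /andP[jq bq].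
case/orP: (cl p q pc qc) => /andP[/subsetP s1 /subsetP s2].
  by case/negP: nbi; rewrite inE; apply/bigcupP; exists q; rewrite // in_area s1.
by case/negP: nbj; rewrite inE; apply/bigcupP; exists p; rewrite // in_area s1.
Qed.

Lemma coef_star_not_totally_ordered G : ~ totally_ordered G -> coef_star G = 0.
Proof.
move=> ntG; rewrite /coef_star big_pred0 ?subr0.
  case: eqP => // G0; case: ntG; apply: nested_totally_ordered => i j.
  by apply/orP; left; apply/subsetP => b; rewrite G0 !inE.
move=> c; apply/negbTE/negP => /andP[cC /eqP cG]; apply: ntG.
by rewrite -cG; apply: nested_totally_ordered => i j; apply: covered_nested.
Qed.

End Rectangles.

(** Among the rectangles of the chain that contain a given row, one with the most columns has all
    columns that occur with this row, hence [B]. Among those containing [B], one with the most rows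
    then contains [A]. *)
Lemma chain_covers_rect n (c : {set {set 'I_n} * {set 'I_n}}) (A B : {set 'I_n}) :
  clique (@rect_comp n) c -> A != set0 -> B != set0 -> area (A, B) \subset covered c ->
  exists2 r, r \in c & (A \subset r.1) && (B \subset r.2).
Proof.
move=> /cliqueP cl /set0Pn[a0 a0A] /set0Pn[b0 b0B] /subsetP sAB.
have cell a b : a \in A -> b \in B -> exists2 r, r \in c & (a \in r.1) && (b \in r.2).
  move=> aA bB; have /bigcupP[r rc] : (a, b) \in covered c by apply: sAB; rewrite in_area aA bB.
  by rewrite in_area; exists r.
have row a : a \in A -> exists2 r, r \in c & (a \in r.1) && (B \subset r.2).
  move=> aA; have [r0 r0c /andP[ar0 _]] := cell a b0 aA b0B.
  have r0P : (r0 \in c) && (a \in r0.1) by rewrite r0c.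
  case: (@arg_maxnP _ r0 (fun r => (r \in c) && (a \in r.1)) (fun r => #|r.2|) r0P).
  move=> r /andP[rc ar] rmax; exists r => //; rewrite ar; apply/subsetP => b bB.
  have [s sc /andP[as1 bs]] := cell a b aA bB.
  have := rmax s; rewrite sc as1 => /(_ isT) le.
  case/orP: (cl r s rc sc) => /andP[_ s2]; first exact: (subsetP s2).
  by have /eqP -> : r.2 == s.2 by rewrite eqEcard s2.
have [r0 r0c /andP[_ Br0]] := row a0 a0A.
have r0P : (r0 \in c) && (B \subset r0.2) by rewrite r0c.
case: (@arg_maxnP _ r0 (fun r => (r \in c) && (B \subset r.2)) (fun r => #|r.1|) r0P).
move=> r /andP[rc Br] rmax; exists r => //; rewrite Br andbT; apply/subsetP => a aA.
have [s sc /andP[as1 Bs]] := row a aA.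
have := rmax s; rewrite sc Bs => /(_ isT) le.
case/orP: (cl r s rc sc) => /andP[s1 _]; last exact: (subsetP s1).
by have /eqP -> : r.1 == s.1 by rewrite eqEcard s1.
Qed.

Lemma binz_nat (a b : nat) : binz a%:Z b%:Z = 'C(a, b)%:R.
Proof.
rewrite /binz ltNge lez_nat leq0n /= ltz_nat natz.
by case: ltnP => // /bin_small ->.
Qed.

Lemma binz_small (a b : int) : a < b -> binz a b = 0.
Proof. by rewrite /binz => ->; rewrite orbT. Qed.

(** * Staircase graphs and their corners *)

Section Staircase.
Variables (n : nat) (G : bgraph n) (p q : {perm 'I_n}) (t : nat) (d k : nat -> nat).
Hypotheses (t_gt0 : (0 < t)%N) (k0 : k 0%N = 0%N) (kt : k t = n).
Hypothesis k_lt : forall j, (1 <= j <= t)%N -> (k j.-1 < k j)%N.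
Hypothesis d_lt : forall j, (1 <= j < t)%N -> (d j < d j.+1)%N.
Hypotheses (dt : (d t <= n)%N) (d0 : d 0%N = 0%N) (dn : d t.+1 = n).
Hypothesis GE : forall j (i b : 'I_n), (1 <= j <= t)%N -> (k j.-1 <= p i < k j)%N ->
  ((i, b) \in G) = (q b < d j)%N.
Local Notation rect := ({set 'I_n} * {set 'I_n})%type.

Lemma k_mono i j : (i <= j <= t)%N -> (k i <= k j)%N.
Proof.
move=> /andP[]; elim: j => [|j IHj] ij jt; first by have -> : i = 0%N by lia.
have [->//|ne] := eqVneq i j.+1.
have := @k_lt j.+1; rewrite /= => h; have := IHj; lia.
Qed.

Lemma d_smono i j : (0 < i < j)%N -> (j <= t)%N -> (d i < d j)%N.
Proof.
move=> /andP[i0]; elim: j => // j IHj ij jt.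
have [->|ne] := eqVneq i j; first by apply: d_lt; lia.
by have := d_lt (j := j); have := IHj; lia.
Qed.

Lemma d_mono i j : (i <= j <= t.+1)%N -> (d i <= d j)%N.
Proof.
have dle h : (h <= t)%N -> (d h <= n)%N.
  move=> ht; have [->|h0] := posnP h; first by rewrite d0.
  have [->//|ne] := eqVneq h t.
  by apply: leq_trans dt; apply/ltnW/d_smono; lia.
move=> /andP[ij jt]; have [->|i0] := posnP i; first by rewrite d0.
have [->//|ne] := eqVneq i j.
have [ej|nj] := eqVneq j t.+1; first by rewrite ej dn dle //; lia.
by apply/ltnW/d_smono; lia.
Qed.

(* The corners 0 and t.+1 are (setT, set0) and (set0, setT): they bound all
   rectangles and are not large. *)
Definition Urows j : {set 'I_n} := [set i | (k j.-1 <= p i)%N].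
Definition Bcols j : {set 'I_n} := [set b | (q b < d j)%N].
Definition corner j : rect := (Urows j, Bcols j).

Lemma card_perm_lt (s : {perm 'I_n}) m : (m <= n)%N -> #|[set i | (s i < m)%N]| = m.
Proof.
move=> lemn; rewrite -[RHS](@card_initial n m) // -(card_imset _ (@perm_inj _ s)).
congr #|pred_of_set _|; apply/setP => x; rewrite inE; apply/imsetP/idP => [[i]|h].
  by rewrite inE => ? ->.
by exists ((s^-1)%g x); rewrite ?inE permKV.
Qed.

Lemma card_Bcols j : (j <= t.+1)%N -> #|Bcols j| = d j.
Proof. by move=> jt; rewrite card_perm_lt // -dn; apply: d_mono; rewrite jt leqnn. Qed.

Lemma card_Urows j : (j <= t.+1)%N -> #|Urows j| = (n - k j.-1)%N.
Proof.
move=> jt; have le : (k j.-1 <= n)%N by rewrite -kt; apply: k_mono; lia.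
rewrite -[in RHS](card_perm_lt p le); set W := [set i | _].
have -> : Urows j = ~: W by apply/setP => i; rewrite !inE -leqNgt.
have arith a b : (a + b = n)%N -> b = (n - a)%N by lia.
by apply: arith; have := cardsC W; rewrite card_ord.
Qed.

Lemma row_class (i : 'I_n) : exists2 j, (1 <= j <= t)%N & (k j.-1 <= p i < k j)%N.
Proof.
have ex : exists j, (p i < k j)%N by exists t; rewrite kt.
case: (ex_minnP ex) => j ltj minj; have jt : (j <= t)%N by apply: minj; rewrite kt.
have j0 : (0 < j)%N by case: (j) ltj => //; rewrite k0.
exists j; rewrite ?j0 ?jt // ltj andbT leqNgt; apply/negP => /minj; lia.
Qed.

Lemma staircase_mem j i b : (1 <= j <= t)%N -> i \in Urows j -> b \in Bcols j -> (i, b) \in G.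
Proof.
move=> hj; rewrite !inE => hi hb; have [h hh hih] := row_class i.
rewrite (GE _ hh hih); apply: leq_trans hb _; apply: d_mono.
have [//|lt] := leqP j h; first by lia.
have := @k_mono h j.-1; lia.
Qed.

Lemma staircase_row j i b : (1 <= j <= t)%N -> i \in Urows j -> i \notin Urows j.+1 ->
  (i, b) \in G -> b \in Bcols j.
Proof. by move=> hj; rewrite !inE -ltnNge /= => h1 h2; rewrite (GE _ hj) ?h1. Qed.

(** As [d] increases strictly, the last column of [Bcols j] lies in no earlier [Bcols h]. *)
Lemma staircase_col j i b : (1 <= j <= t)%N -> q b = (d j).-1 :> nat -> (0 < d j)%N ->
  (i, b) \in G -> i \in Urows j.
Proof.
move=> hj hb dj; have [h hh hih] := row_class i; rewrite (GE _ hh hih) inE hb => lt.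
have [le|lt'] := leqP j h; first by apply: leq_trans (_ : k h.-1 <= _)%N; [apply: k_mono|]; lia.
by have := @d_smono h j; lia.
Qed.

Lemma corner_mono i j : (i <= j <= t.+1)%N -> rect_le (corner j) (corner i).
Proof.
move=> hij; apply/andP; split; apply/subsetP => x; rewrite !inE => h.
  by apply: leq_trans h; apply: k_mono; lia.
by apply: leq_trans h _; apply: d_mono.
Qed.

(** Requiring [0 < d j] leaves out the first corner when it has no columns, that is when
    [d 1 = 0]. *)
Definition corner_idx : {set 'I_t.+1} := [set j : 'I_t.+1 | (0 < j)%N && (0 < d j)%N].

Definition corners : {set rect} := [set corner (val j) | j in corner_idx].

Lemma cornersP r :
  reflect (exists2 j, (1 <= j <= t)%N && (0 < d j)%N & r = corner j) (r \in corners).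
Proof.
apply: (iffP imsetP) => [[j]|[j]].
  by rewrite inE => /andP[j0 dj] ->; exists (val j); rewrite // j0 dj -ltnS /= ltn_ord.
move=> /andP[/andP[j0 jt] dj] ->; rewrite -ltnS in jt; exists (Ordinal jt) => //.
by rewrite inE /= j0 dj.
Qed.

Lemma corner_area_sub j : (1 <= j <= t)%N -> area (corner j) \subset G.
Proof.
move=> hj; apply/subsetP => -[i b]; rewrite in_area => /andP[iU bB].
exact: staircase_mem hj iU bB.
Qed.

Lemma chain_covering_staircase (c : {set rect}) :
  (c \in chains n) && (covered c == G)
  = [&& c \subset rects G, clique (@rect_comp n) c & corners \subset c].
Proof.
rewrite inE subset_rects -!andbA; case: [forall _ in _, _] => //=.
rewrite [RHS]andbCA; case: (boolP (clique _ c)) => //= cl.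
apply/eqP/andP => [cG|[sG /subsetP sK]]; last first.
  apply/eqP; rewrite eqEsubset sG /=; apply/subsetP => -[i b] ibG.
  have [j hj hij] := row_class i; have ltb : (q b < d j)%N by rewrite -(GE _ hj hij).
  apply/bigcupP; exists (corner j); last by rewrite in_area !inE ltb; case/andP: hij => ->.
  by apply/sK/cornersP; exists j => //; rewrite hj (leq_ltn_trans _ ltb).
split; first by rewrite cG.
apply/subsetP => r /cornersP[j /andP[hj dj] ->].
have kn : (k j.-1 < n)%N by rewrite -kt; apply: leq_trans (k_lt hj) _; apply: k_mono; lia.
have dln : ((d j).-1 < n)%N by rewrite -dn; have := @d_mono j t.+1; lia.
(* Row [i] has exactly the neighbours [Bcols j], and column [b] meets only rows of [Urows j]. A
   rectangle in [G] containing both therefore fits into [corner j]. *)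
pose i := (p^-1)%g (Ordinal kn); pose b := (q^-1)%g (Ordinal dln).
have pi : p i = k j.-1 :> nat by rewrite permKV.
have qb : q b = (d j).-1 :> nat by rewrite permKV.
have iU : i \in Urows j by rewrite inE pi.
have bB : b \in Bcols j by rewrite inE qb; lia.
have niU : i \notin Urows j.+1 by rewrite inE /= pi -ltnNge k_lt.
have [|||[S T] rc /andP[/= sU sB]] := @chain_covers_rect n c (Urows j) (Bcols j) cl.
- by apply/set0Pn; exists i.
- by apply/set0Pn; exists b.
- by rewrite cG; apply: corner_area_sub.
have inG x y : x \in S -> y \in T -> (x, y) \in G.
  by move=> xS yT; rewrite -cG; apply/bigcupP; exists (S, T) => //; rewrite in_area xS.
suff -> : corner j = (S, T) by [].
congr (_, _); apply/eqP; rewrite eqEsubset ?sU ?sB /=; apply/subsetP => x xS.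
  by apply: (staircase_col hj qb dj); apply: inG xS (subsetP sB _ bB).
by apply: (staircase_row hj iU niU); apply: inG (subsetP sU _ iU) xS.
Qed.

(** * Segments between consecutive corners *)

Definition segment j : {set rect} :=
  [set r in rects G | [&& rect_le (corner j.+1) r, rect_le r (corner j),
                          r != corner j.+1 & r != corner j]].

Lemma large_neq0 (r : rect) : large r -> (r.1 != set0) /\ (r.2 != set0).
Proof.
have b (S : {set 'I_n}) : (#|S| <= n)%N by rewrite -[X in (_ <= X)%N]card_ord max_card.
rewrite /large => lr; split; apply: contraL lr => /eqP->; rewrite cards0 -leqNgt.
  by rewrite add0n b.
by rewrite addn0 b.
Qed.

Lemma corner0_notin j : d j = 0%N -> corner j \notin rects G.
Proof.
move=> dj; rewrite inE; apply/negP => /andP[/large_neq0[_ /set0Pn[b bB]] _].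
by rewrite /= inE dj in bB.
Qed.

(** For the largest [j] with [r] below [corner j], comparability puts [r] above [corner j.+1]. *)
Lemma link_corners : link (@rect_comp n) (rects G) corners = \bigcup_(j < t.+1) segment j.
Proof.
apply/setP => r; rewrite inE in_setD; apply/idP/bigcupP; last first.
  move=> [[j jt] _ /=]; rewrite inE => /and5P[rR le1 le2 ne1 ne2]; rewrite rR andbT.
  have cmp i : (i <= t.+1)%N ->
      rect_le (corner i) r && (i > j)%N || rect_le r (corner i) && (i <= j)%N.
    move=> it; have [ij|ji] := leqP i j; rewrite ?andbF ?andbT /= ?orbF.
      by apply: rect_le_trans le2 _; apply: corner_mono; lia.
    by apply: rect_le_trans _ le1; apply: corner_mono; lia.
  apply/andP; split; last first.
    apply/forall_inP => s /cornersP[i /andP[hi _] ->].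
    by have /orP[/andP[h _]|/andP[h _]] := cmp i ltac:(lia); rewrite /rect_comp /comp_rel h ?orbT.
  apply/negP => /cornersP[i /andP[hi _] er].
  have [ij|ji] := leqP i j.
    case/eqP: ne2; apply: rect_le_anti; rewrite le2 er.
    by apply: corner_mono; lia.
  by case/eqP: ne1; apply: rect_le_anti; rewrite le1 er corner_mono //; lia.
move=> /andP[/andP[nK rR] /forall_inP cK].
have /andP[/large_neq0[/set0Pn[i0 i0r] _] _] : large r && (area r \subset G) by rewrite inE in rR.
have ex : exists j, (j <= t)%N && rect_le r (corner j).
  exists 0%N; rewrite /rect_le /=; apply/andP; split; apply/subsetP => x; rewrite !inE /=.
    by rewrite k0.
  by rewrite d0.
have bnd j : (j <= t)%N && rect_le r (corner j) -> (j <= t)%N by case/andP.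
case: (ex_maxnP ex bnd) => j /andP[jt le2] jmax.
have nle1 : ~~ rect_le r (corner j.+1).
  apply/negP => h; have [ejt|ne] := eqVneq j t.
    case/andP: h => /subsetP/(_ i0 i0r); rewrite inE ejt /= kt.
    by rewrite leqNgt ltn_ord.
  by have := jmax j.+1; rewrite h andbT; lia.
have nj : r != corner j.
  apply: contraNneq nK => er; have [dj|dj] := posnP (d j).
    by move: rR; rewrite er (negbTE (corner0_notin dj)).
  apply/cornersP; exists j => //; rewrite dj jt !andbT lt0n.
  by apply: contraTneq dj => ->; rewrite d0.
have n1 : r != corner j.+1 by apply: contraNneq nle1 => <-; apply: rect_le_refl.
have jt' : (j < t.+1)%N by rewrite ltnS.
exists (Ordinal jt') => //=; rewrite inE rR le2 nj n1 !andbT.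
(* The corner [t.+1] is not in [corners], but it lies below every rectangle. *)
have [ejt|ne] := eqVneq j t.
  rewrite /rect_le /=; apply/andP; split; apply/subsetP => x; rewrite !inE ejt /= ?kt ?dn //.
  by rewrite leqNgt ltn_ord.
(* Here [j = 0], and [corner 1] would be the top [(setT, set0)], against [nle1]. *)
have [dj|dj] := posnP (d j.+1).
  case/negP: nle1; rewrite /rect_le /=; apply/andP; split; last first.
    by apply/subsetP => x; rewrite inE dj.
  have ej : j = 0%N by have [//|j0] := posnP j; have := d_lt (j := j); lia.
  by apply/subsetP => x _; rewrite inE ej k0.
have : rect_comp (corner j.+1) r by apply/cK/cornersP; exists j.+1 => //; lia.
by rewrite /rect_comp /comp_rel (negbTE nle1) orbF.
Qed.

(** The indicator appears because a corner that is not large belongs to no chain, so that no chain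
    covers [G]. *)
Lemma sum_chains_staircase :
  \sum_(c in chains n | covered c == G) (-1) ^+ #|c| =
  (corners \subset rects G)%:R *
  ((-1) ^+ #|corners| * \prod_(j < t.+1) chi (@rect_comp n) (segment j)) :> int.
Proof.
rewrite (eq_bigl _ _ chain_covering_staircase); case: (boolP (corners \subset _)) => sK; last first.
  rewrite big_pred0 ?mul0r // => c; apply/negbTE/negP => /and3P[sc _ sKc].
  by rewrite (subset_trans sKc sc) in sK.
rewrite mul1r sum_cliques_containing //; first last.
- apply/cliqueP => r s /cornersP[i /andP[hi _] ->] /cornersP[j /andP[hj _] ->].
  by case: (leqP i j) => hij; apply/orP; [right|left]; apply: corner_mono; lia.
- exact: rect_comp_sym.
rewrite link_corners chi_bigjoin //.
- exact: rect_comp_refl.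
- exact: rect_comp_sym.
- move=> i j hij; rewrite -setI_eq0; apply/eqP/setP => r; rewrite !inE.
  apply/negP => /andP[/and5P[_ le1 _ ne1 _] /and5P[_ _ le2 _ _]].
  case/eqP: ne1; apply: rect_le_anti; rewrite le1 andbT.
  by apply: rect_le_trans le2 _; apply: corner_mono; lia.
- move=> i j hij r s; rewrite !inE => /and5P[_ le1 _ _ _] /and5P[_ _ le2 _ _].
  apply/orP; right; apply: rect_le_trans le2 _; apply: rect_le_trans _ le1.
  by apply: corner_mono; lia.
Qed.

(** A row of [r] outside [Urows j.+1] has only the neighbours [Bcols j], which bounds the columns of
    [r]. *)
Lemma segment_shape j r : (j <= t)%N -> r \in segment j ->
  r.1 = Urows j.+1 \/ r.2 = Bcols j.
Proof.
move=> jt; rewrite inE => /and5P[rR /andP[/= s1 _] /andP[/= s2 s3] _ _].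
have [sU|/subsetPn[i ir niU]] := boolP (r.1 \subset Urows j.+1); [left|right].
  by apply/eqP; rewrite eqEsubset sU.
have j0 : (0 < j)%N.
  by rewrite lt0n; apply: contraNneq niU => ->; rewrite inE k0.
apply/eqP; rewrite eqEsubset s3 andbT; apply/subsetP => b br.
apply: (@staircase_row j i b) => //; first by rewrite j0.
  exact: (subsetP s2).
move: rR; rewrite inE => /andP[_ /subsetP]; apply.
by case: (r) ir br => S T iS bT; rewrite in_area iS bT.
Qed.

Lemma k_le_n j : (j <= t)%N -> (k j <= n)%N.
Proof. by move=> jt; rewrite -kt; apply: k_mono; rewrite jt leqnn. Qed.

(* The reentrant corner (Urows j.+1, Bcols j) is then the apex of the cone. *)
Lemma segment_cone j : (1 <= j <= t)%N -> (k j < d j)%N -> chi (@rect_comp n) (segment j) = 0.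
Proof.
move=> hj lt; have jt : (j < t)%N.
  rewrite ltn_neqAle; case/andP: (hj) => _ ->; rewrite andbT.
  by apply: contraTneq lt => ->; rewrite kt -leqNgt.
have /andP[/= sU sB] := @corner_mono j j.+1 ltac:(lia).
have cU := @card_Urows j ltac:(lia); have cU' := @card_Urows j.+1 ltac:(lia).
have cB := @card_Bcols j ltac:(lia); have cB' := @card_Bcols j.+1 ltac:(lia).
have dj := d_lt (j := j); have kj := k_lt hj; have kn := @k_le_n j ltac:(lia).
apply: (@chi_cone _ _ (@rect_comp_refl n) (@rect_comp_sym n) _ (Urows j.+1, Bcols j)).
  (* The reentrant corner has semiperimeter [n - k j + d j], so it is large because [k j < d j]. *)
  rewrite inE inE /large /rect_le /= sU sB !subxx cU' cB /=.
  apply/andP; split; first (apply/andP; split; first by lia).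
    apply/subsetP => -[i b]; rewrite in_area /= => /andP[iU bB].
    by apply: staircase_mem hj _ bB; apply: (subsetP sU).
  apply/andP; split; apply/eqP => -[] e.
    by have h : d j = d j.+1; [rewrite -cB -cB' e|lia].
  by have h : (n - k j)%N = (n - k j.-1)%N; [rewrite -cU -e cU'|lia].
move=> r rS; have := rS; rewrite inE => /and5P[_ /andP[/= s1 _] /andP[/= _ s2] _ _].
apply/orP; have [e|e] := segment_shape (ltnW jt) rS.
  by right; rewrite /rect_le e subxx /= s2.
by left; rewrite /rect_le e s1 /=.
Qed.

(** Largeness reads [k j < #|T|] over the rows [Urows j.+1] and [n - d j < #|S|] over the columns
    [Bcols j]. Both bounds exceed the least size in the interval by [k j - d j]. *)
Lemma segmentE j : (j <= t)%N -> (d j <= k j)%N ->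
  segment j = [set (Urows j.+1, T) | T in tcube (Bcols j) (Bcols j.+1) (k j - d j)]
          :|: [set (S, Bcols j) | S in tcube (Urows j.+1) (Urows j) (k j - d j)].
Proof.
move=> jt le; have /andP[/= sU sB] := @corner_mono j j.+1 ltac:(lia).
have cU := @card_Urows j ltac:(lia); have cU' := @card_Urows j.+1 ltac:(lia).
have cB := @card_Bcols j ltac:(lia); have cB' := @card_Bcols j.+1 ltac:(lia).
have kn := @k_le_n j ltac:(lia).
apply/setP => -[S T]; rewrite [RHS]inE; apply/idP/orP.
  move=> rS; have := rS; rewrite inE => /and5P[rR /andP[/= s1 s2] /andP[/= s3 s4] ne1 ne2].
  move: rR; rewrite inE /large /= => /andP[lg _].
  have [/= e|/= e] := segment_shape jt rS; [left|right]; apply/imsetP.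
    exists T; rewrite ?e // inE s4 properEneq s2 cB !andbT /=.
    move: lg ne1; rewrite e cU' xpair_eqE eqxx /= => lg ->; move: lg; lia.
  exists S; rewrite ?e // inE s1 properEneq s3 cU' !andbT /=.
  move: lg ne2; rewrite e cB xpair_eqE eqxx andbT /= => lg ->; move: lg; lia.
case=> /imsetP[A]; rewrite inE => /and3P[sA pA cA] [-> ->];
  rewrite inE inE /large /rect_le /= !subxx ?sU ?sB.
  rewrite sA (proper_sub pA) !andbT /=; rewrite cB in cA.
  have pc := proper_card pA; rewrite cB' in pc.
  have jt' : (j < t)%N.
    rewrite ltn_neqAle jt andbT; apply: contraTneq pc => ej.
    by rewrite -leqNgt ej dn; move: cA le; rewrite ej kt; lia.
  apply/andP; split; first (apply/andP; split).
  - by rewrite cU' /=; move: cA => /=; lia.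
  - apply/subsetP => -[i b]; rewrite in_area /= => /andP[iU bA].
    by apply: (@staircase_mem j.+1) => //; apply: (subsetP (proper_sub pA)).
  - apply/andP; split; apply/eqP; first by case=> e; rewrite e properxx in pA.
    by case=> _ e; move: cA; rewrite e cB; lia.
rewrite sA (proper_sub pA) !andbT /=; rewrite cU' /= in cA.
have pc := proper_card pA; rewrite cU in pc.
have j0 : (0 < j)%N.
  by rewrite lt0n; apply: contraTneq pc => ej; rewrite -leqNgt; move: cA; rewrite ej /= !k0 d0; lia.
apply/andP; split; first (apply/andP; split).
- by rewrite cB /=; move: cA => /=; lia.
- apply/subsetP => -[i b]; rewrite in_area /= => /andP[iA bB].
  by apply: (@staircase_mem j) => //; [rewrite j0|apply: (subsetP (proper_sub pA))].
- apply/andP; split; apply/eqP; last by case=> e; rewrite e properxx in pA.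
  by case=> e _; move: cA; rewrite e cU' /=; lia.
Qed.

(** The first family of [segmentE] lies entirely below the second, so the segment is a join. Columns
    are ordered by reverse inclusion, which [nested] does not distinguish. *)
Lemma chi_segment j : (j <= t)%N -> (d j <= k j)%N ->
  chi (@rect_comp n) (segment j)
  = chi (@nested _) (tcube (Bcols j) (Bcols j.+1) (k j - d j))
    * chi (@nested _) (tcube (Urows j.+1) (Urows j) (k j - d j)).
Proof.
move=> jt le; rewrite segmentE // chi_join; first last.
- move=> r s /imsetP[T hT ->] /imsetP[S hS ->].
  move: hT hS; rewrite !inE => /and3P[sB _ _] /and3P[sU _ _].
  by apply/orP; left; rewrite /rect_le /= sU sB.
- rewrite -setI_eq0; apply/eqP/setP => r; rewrite !inE.
  apply/negP => /andP[/imsetP[T hT ->] /imsetP[S hS [_ eT]]].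
  by move: hT; rewrite inE eT => /and3P[_ _]; lia.
- exact: rect_comp_sym.
- exact: rect_comp_refl.
congr (_ * _); apply: chi_imset.
- by move=> A A' [].
- by move=> A A'; rewrite /rect_comp /comp_rel /rect_le /nested /= subxx orbC.
- by move=> A A' [].
- by move=> A A'; rewrite /rect_comp /comp_rel /rect_le /nested /= subxx !andbT.
Qed.

(** * Large corners, and the binomial value and sign of each segment *)

Lemma corner_in_rects j : (1 <= j <= t)%N -> (corner j \in rects G) = (k j.-1 < d j)%N.
Proof.
move=> hj; rewrite inE corner_area_sub // andbT /large /=.
rewrite card_Urows ?card_Bcols; try lia.
by have := @k_le_n j.-1; lia.
Qed.

Lemma corners_largeP :
  reflect (forall j, (1 <= j <= t)%N -> (0 < d j)%N -> (k j.-1 < d j)%N) (corners \subset rects G).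
Proof.
apply: (iffP subsetP) => [h j hj dj|h r /cornersP[j /andP[hj dj] ->]].
  by rewrite -corner_in_rects //; apply: h; apply/cornersP; exists j; rewrite // hj dj.
by rewrite corner_in_rects // h.
Qed.

(* The value -1 at a column set of size 0 makes the formula for the segments
   below uniform, although such a corner does not belong to [corners]. *)
Definition corner_sign j : int := if d j == 0%N then -1 else (-1) ^+ (d j - k j.-1).-1.

Lemma corner_sign_sqr j : corner_sign j * corner_sign j = 1.
Proof. by rewrite /corner_sign; case: ifP => _; rewrite ?mulrNN ?mulr1 // -expr2 sqrr_sign. Qed.

Local Notation fstep j := (fcoef ((d j.+1)%:Z - (k j.-1)%:Z) ((d j)%:Z - (k j.-1)%:Z)
                                 ((k j)%:Z - (k j.-1)%:Z)).
Local Notation flast := (binz (n%:Z - (k t.-1)%:Z - 1) (n%:Z - (d t)%:Z)).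

Lemma chi_cols j : (j <= t)%N -> (d j <= k j)%N -> (k j < d j.+1)%N ->
  chi (@nested _) (tcube (Bcols j) (Bcols j.+1) (k j - d j))
  = (-1) ^+ (d j.+1 - k j).-1 * 'C((d j.+1 - d j).-1, k j - d j)%:R.
Proof.
move=> jt le lt; have /andP[/= _ sB] := @corner_mono j j.+1 ltac:(lia).
rewrite chi_tcube ?card_Bcols //; try lia.
by congr ((-1) ^+ _.-1 * _); lia.
Qed.

Lemma chi_rows j : (1 <= j <= t)%N -> (d j <= k j)%N -> (k j.-1 < d j)%N ->
  chi (@nested _) (tcube (Urows j.+1) (Urows j) (k j - d j))
  = (-1) ^+ (d j - k j.-1).-1 * 'C((k j - k j.-1).-1, k j - d j)%:R.
Proof.
move=> hj le lt; have /andP[/= sU _] := @corner_mono j j.+1 ltac:(lia).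
have kn := @k_le_n j ltac:(lia); have kl := k_lt hj.
rewrite chi_tcube ?card_Urows //=; try lia.
have -> : (n - k j.-1 - (n - k j))%N = (k j - k j.-1)%N by lia.
by congr ((-1) ^+ _.-1 * _); lia.
Qed.

Lemma chi_segment_mid j : corners \subset rects G -> (1 <= j < t)%N ->
  chi (@rect_comp n) (segment j) = - (corner_sign j * corner_sign j.+1 * fstep j).
Proof.
move=> /corners_largeP okK hj; have hj' : (1 <= j <= t)%N by lia.
have dj := d_lt hj; have kj := k_lt hj'.
have lt1 : (k j < d j.+1)%N by apply: (okK j.+1); lia.
(* For [k j < d j] the segment is a cone, and the second binomial of [fcoef] vanishes. *)
have [lekd|ltdk] := leqP (d j) (k j); last first.
  rewrite segment_cone // /fcoef ifF; last by lia.
  by rewrite (@binz_small (_ - _ - 1) (_ - 1)) ?mulr0 ?oppr0 ?mulr0 ?oppr0 //; lia.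
rewrite chi_segment ?chi_cols //; try lia.
have -> : corner_sign j.+1 = (-1) ^+ (d j.+1 - k j).-1 by rewrite /corner_sign ifF //; lia.
(* If [d j = 0] then [j = 1], the row family is empty, and [fcoef] takes its first branch. *)
have [dj0|dj0] := posnP (d j).
  have ej : j = 1%N by have [j1|j1] := leqP j 1; [lia|have := @d_smono 1 j; lia].
  subst j; rewrite /= k0 dj0 !subn0 in lekd lt1 *.
  have cU := card_Urows (j := 1); have cU' := card_Urows (j := 2).
  rewrite chi_tcube_small; last by rewrite cU ?cU' /= ?k0; have := @k_le_n 1; lia.
  have -> : fcoef ((d 2)%:Z - 0%N%:Z) (0%N%:Z - 0%N%:Z) ((k 1)%:Z - 0%N%:Z) = 'C((d 2).-1, k 1)%:R.
    rewrite /fcoef subrr lexx !subr0 -binz_nat; congr (binz _ _); lia.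
  by rewrite /corner_sign dj0 eqxx; ring.
have lt0 : (k j.-1 < d j)%N by apply: okK.
rewrite chi_rows // /corner_sign ifF; last by lia.
rewrite /fcoef ifF; last by lia.
have -> : (d j.+1)%:Z - (k j.-1)%:Z - ((d j)%:Z - (k j.-1)%:Z) - 1 = (d j.+1 - d j).-1%:Z by lia.
have -> : (k j)%:Z - (k j.-1)%:Z - ((d j)%:Z - (k j.-1)%:Z) = (k j - d j)%N%:Z by lia.
have -> : (k j)%:Z - (k j.-1)%:Z - 1 = (k j - k j.-1).-1%:Z by lia.
have -> : (d j)%:Z - (k j.-1)%:Z - 1 = (d j - k j.-1).-1%:Z by lia.
(* The rows give the binomial with lower index [k j - d j]; symmetry matches it with the one in
   [fcoef]. *)
rewrite !binz_nat -[in RHS](bin_sub (m := (d j - k j.-1).-1)); last by lia.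
have -> : ((k j - k j.-1).-1 - (d j - k j.-1).-1)%N = (k j - d j)%N by lia.
by ring.
Qed.

Lemma chi_segment_last : corners \subset rects G -> (0 < d t)%N ->
  chi (@rect_comp n) (segment t) = corner_sign t * flast.
Proof.
move=> /corners_largeP okK dt0; have ht : (1 <= t <= t)%N by lia.
have dk : (d t <= k t)%N by rewrite kt.
rewrite chi_segment //.
(* The column family is empty: no set of columns has more than [k t = n] elements. *)
rewrite chi_tcube_small ?mul1r; last first.
  by rewrite (card_Bcols (j := t)) // (card_Bcols (j := t.+1)) // dn kt; lia.
rewrite chi_rows //; last exact: okK.
rewrite kt.
rewrite /corner_sign ifF; last by lia.
have := okK t ht dt0 => lt.
have -> : n%:Z - (k t.-1)%:Z - 1 = (n - k t.-1).-1%:Z by lia.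
have -> : n%:Z - (d t)%:Z = (n - d t)%N%:Z by lia.
by rewrite binz_nat.
Qed.

Lemma chi_segment_first : corners \subset rects G ->
  chi (@rect_comp n) (segment 0) = if d 1%N == 0%N then 1 else corner_sign 1.
Proof.
move=> /corners_largeP okK; rewrite chi_segment ?d0 //.
(* Corners 0 and 1 both have all rows, as [0.-1 = 0] and [k 0 = 0]; only column sets remain. *)
have cU : #|Urows 0| = n by rewrite card_Urows // k0 subn0.
have cU' : #|Urows 1| = n by rewrite card_Urows // k0 subn0.
rewrite [X in _ * X]chi_tcube_small ?mulr1; last by rewrite cU ?cU' k0; lia.
case: eqP => [d1|/eqP d1].
  by rewrite chi_tcube_small // !card_Bcols // d1 d0.
have -> : (k 0 - 0 = k 0 - d 0)%N by rewrite d0.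
rewrite chi_cols ?d0 ?k0 ?lt0n // bin0 mulr1 /corner_sign /= k0.
by rewrite (negbTE d1).
Qed.

Lemma card_corners : #|corners| = (t.-1 + (0 < d 1%N))%N.
Proof.
rewrite card_in_imset; last first.
  move=> i j; rewrite !inE => /andP[i0 _] /andP[j0 _] [_ /(congr1 (fun A : {set 'I_n} => #|A|))].
  rewrite !card_Bcols; try by apply/ltnW/ltn_ord.
  move=> e; apply: val_inj; have := ltn_ord i; have := ltn_ord j; rewrite !ltnS => jt it.
  by case: (ltngtP i j) => // h; [have := @d_smono i j|have := @d_smono j i];
    move: e i0 j0 h jt it; rewrite /=; lia.
have -> : #|corner_idx| = (\sum_(j < t.+1) ((0 < j) && (0 < d j)))%N.
  by rewrite -sum1_card big_mkcond; apply: eq_bigr => j _; rewrite inE; case: (_ && _).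
move: (t) t_gt0 d_lt => [] // m _ dlt.
rewrite !big_ord_recl /= add0n addnC; congr (_ + _)%N.
rewrite (eq_bigr (fun=> 1%N)) ?sum1_card ?card_ord // => i _.
by have := dlt i.+1; have := ltn_ord i; rewrite /bump /= !add1n; lia.
Qed.

(* Each sign occurs in two consecutive segments, so the signs cancel. *)
Lemma sign_product m : (m < t)%N -> corners \subset rects G ->
  \prod_(1 <= j < m.+1) chi (@rect_comp n) (segment j)
  = (-1) ^+ m * corner_sign 1 * corner_sign m.+1 * \prod_(1 <= j < m.+1) fstep j.
Proof.
move=> mt okK; elim: m mt => [|m IHm] mt.
  by rewrite !big_geq // expr0 mul1r mulr1 corner_sign_sqr.
rewrite !(big_nat_recr m.+1) //= IHm ?chi_segment_mid //; try lia.
have := corner_sign_sqr m.+1.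
move: (corner_sign m.+1) (corner_sign m.+2) (corner_sign 1) => s s' s1 e.
move: (\prod_(_ <= _ < _) _) (fcoef _ _ _) => P f; rewrite exprS.
transitivity (- ((-1) ^+ m * s1 * (s * s) * s' * P * f)); first by ring.
by rewrite e; ring.
Qed.

(** Large rectangles are nonempty, so only the empty chain covers the empty graph, and its term
    cancels the constant 1. *)
Lemma coef_star_empty : coef_star (set0 : bgraph n) = 0.
Proof.
rewrite /coef_star eqxx (big_pred1 set0) ?cards0 ?subrr // => c; rewrite [in LHS]inE.
apply/idP/eqP => [/andP[/andP[/forall_inP lg _] /eqP cov]|->]; last first.
  apply/andP; split; last by rewrite /covered big_set0.
  by apply/andP; split; [apply/forall_inP => x|apply/cliqueP => x y]; rewrite inE.
apply/setP => r; rewrite [RHS]inE; apply/negP => rc.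
have [/set0Pn[i ir] /set0Pn[b br]] := large_neq0 (lg r rc).
have : (i, b) \in covered c by apply/bigcupP; exists r; rewrite // in_area ir br.
by rewrite cov inE.
Qed.

Lemma coef_star_staircase : coef_star G = flast * \prod_(1 <= i < t) fstep i.
Proof.
(* If [d t = 0], the graph is empty and the leading binomial has lower index [n] and upper index
   [n - 1]. *)
have [dt0|dt0] := posnP (d t).
  have t1 : t = 1%N by have [j1|j1] := leqP t 1; [lia|have := @d_smono 1 t; lia].
  have -> : G = set0.
    apply/setP => -[i b]; rewrite inE; have [j hj hij] := row_class i; rewrite (GE _ hj hij).
    have -> : j = t by lia.
    by rewrite dt0.
  rewrite coef_star_empty binz_small ?mul0r //.
  by rewrite dt0 t1 /= k0; lia.
rewrite /coef_star sum_chains_staircase.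
have -> : (G == set0) = false.
  apply/negbTE/set0Pn.
  have [|i iU] := card_gt0P (_ : 0 < #|Urows t|)%N.
    by rewrite card_Urows // subn_gt0; have := k_lt (j := t); rewrite kt; lia.
  have [|b bB] := card_gt0P (_ : 0 < #|Bcols t|)%N; first by rewrite card_Bcols.
  by exists (i, b); apply: (@staircase_mem t) => //; rewrite t_gt0 leqnn.
rewrite sub0r; case: (boolP (corners \subset _)) => okK; last first.
  rewrite mul0r oppr0.
  (* A corner [h] that is not large has [d h <= k h.-1], which makes the factor of index [h.-1]
     vanish. *)
  suff [j hj f0] : exists2 j, (1 <= j < t)%N & fstep j = 0.
    by rewrite (big_cat_nat (n := j)) /= ?(big_ltn (m := j)) ?f0 ?mul0r ?mulr0 //; lia.
  have [j /and3P[hj dj lt]] : exists j, [&& (1 <= j <= t)%N, (0 < d j)%N & (d j <= k j.-1)%N].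
    have /subsetPn[r /cornersP[j /andP[hj dj] ->] nr] := okK.
    by exists j; rewrite hj dj leqNgt -corner_in_rects.
  case: j hj dj lt => [|[|j]] // hj dj lt; first by rewrite /= k0 in lt; lia.
  exists j.+1; first by lia.
  rewrite /fcoef /= in lt *; have kj := @k_lt j.+1; rewrite /= in kj.
  case: ifP => h; first by rewrite binz_small //; lia.
  by rewrite [X in X * _]binz_small ?mul0r ?oppr0 //; lia.
have tE : t = t.-1.+1 by lia.
(* When [d 1 = 0] there is one corner fewer, and [corner_sign 1 = -1] makes up for the missing
   sign. *)
have e0 : (-1) ^+ #|corners| * chi (@rect_comp n) (segment 0) = - ((-1) ^+ t.-1 * corner_sign 1).
  rewrite card_corners chi_segment_first //; case: (posnP (d 1%N)) => [d1|d1].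
    by rewrite /corner_sign d1 eqxx addn0 mulr1 mulrN1 opprK.
  by rewrite addn1 exprS mulN1r mulNr.
have := @sign_product t.-1 ltac:(lia) okK; rewrite -tE => sp.
rewrite mul1r -(big_mkord xpredT (fun j => chi (@rect_comp n) (segment j))).
rewrite big_nat_recr //= big_ltn // sp chi_segment_last // !mulrA e0.
have := corner_sign_sqr 1; have := corner_sign_sqr t; have := sqrr_sign int t.-1.
move: (corner_sign 1) (corner_sign t) ((-1) ^+ t.-1 : int) => s1 st u eu et e1.
move: (\prod_(_ <= _ < _) _) flast => P f.
transitivity (u ^+ 2 * (s1 * s1) * (st * st) * (f * P)); first by ring.
by rewrite eu e1 et !mul1r.
Qed.

End Staircase.

(** * Transfer to an arbitrary representation and representing sequence *)

Theorem theorem1 (R : realType) (n : nat) (n_gt0 : (0 < n)%N)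
    (astar : {set 'I_n * 'I_n} -> R)
    (astarP : represents astar (@BPMstar n))
    (G : {set 'I_n * 'I_n}) :
  (~ totally_ordered G -> astar G = 0) /\
  (totally_ordered G ->
   forall (t : nat) (d k : nat -> nat), representing_seq G t d k ->
     astar G =
       (binz (n%:Z - (k t.-1)%:Z - 1) (n%:Z - (d t)%:Z) *
        \prod_(1 <= i < t)
          fcoef ((d i.+1)%:Z - (k i.-1)%:Z)
                ((d i)%:Z - (k i.-1)%:Z)
                ((k i)%:Z - (k i.-1)%:Z))%:~R).
Proof.
rewrite (represents_unique astarP (@represents_coef_star n R)).
split=> [ntG|_ t d k [p [q [_ [t0 [k0 kt] klt [dlt dt] nbrG]]]]].
  by rewrite coef_star_not_totally_ordered.
(* Normalise the irrelevant values of d at 0 and t.+1. *)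
pose d' j := if j == 0%N then 0%N else if (t < j)%N then n else d j.
have dE j : (1 <= j <= t)%N -> d' j = d j.
  by move=> hj; rewrite /d' !ifF //; lia.
congr (_%:~R); rewrite (@coef_star_staircase n G p q t d' k) //.
- rewrite dE ?t0 ?leqnn //; congr (_ * _); apply: eq_big_nat => i hi.
  by rewrite !dE //; lia.
- by move=> j hj; rewrite !dE ?dlt //; lia.
- by rewrite dE ?t0 ?leqnn.
- by rewrite /d' ltnSn.
- move=> j i b hj hi; rewrite dE // -(nbr_relabel p q) (nbrG j _ hj hi) inE //.
Qed.
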